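(* Let $\mathcal{M}$ be an open quantum random walk with operators $(B^i_j)_{i,j\in\Lambda}$, let $\rho=p\otimes|k\rangle\langle k|$ be an initial density operator ($k\in\Lambda$, $p$ a density operator on $\mathcal{H}$), and let $Q\in B(\mathcal{H})$ be a projection. Let $\varphi^t_{p,k}$ be the quantum Markov chain on $\bigotimes_{n\in\mathbb{Z}_+}B(\mathcal{H}\otimes\mathcal{K})$ associated with the Markov pair $(\rho,\mathcal{E}^t)$, where $$\mathcal{E}^t(x\otimes y)=\sum_{i,j\in\Lambda}\mathrm{Tr}\big((p\otimes|j\rangle\langle j|)x\big)\,(M^i_j)^*\,y\,M^i_j .$$ Then: (i) if $\mathrm{Tr}(pQ)=1$, then the projection $Q\otimes|k\rangle\langle k|$ is $\varphi^t_{p,k}$-recurrent if and only if $\mathbb{P}_{p,k}(t_k<\infty)=1$; (ii) if $\mathrm{Tr}(pQ)<1$, then the projection $\mathbf{1}-(Q\otimes|k\rangle\langle k|)$ is $\varphi^t_{p,k}$-recurrent.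
   Context: Open quantum random walk (OQRW): $\Lambda$ is a finite or countable set, $\mathcal{K}$ a separable Hilbert space with orthonormal basis $(|i\rangle)_{i\in\Lambda}$, $\mathcal{H}$ a Hilbert space, and $B^i_j$ ($i,j\in\Lambda$) are bounded operators on $\mathcal{H}$ with $\sum_i B_j^{i*}B_j^i=\mathbf{1}$ for every $j$ (strong convergence). Put $M^i_j=B^i_j\otimes|i\rangle\langle j|$ and $\mathcal{M}(\rho)=\sum_{i,j}M^i_j\rho M^{i*}_j$. $\mathbb{P}_{p,k}$ is the probability measure on $\Lambda^{\mathbb{Z}_+}$ (with the cylinder $\sigma$-algebra), concentrated on $\{\omega:\omega_0=k\}$, with $$\mathbb{P}_{p,k}(\{\omega:\omega_0=k,\omega_1=i_1,\dots,\omega_n=i_n\})=\mathrm{Tr}\big(B^{i_n}_{i_{n-1}}\cdots B^{i_2}_{i_1}B^{i_1}_{k}\,p\,B^{i_1*}_{k}B^{i_2*}_{i_1}\cdots B^{i_n*}_{i_{n-1}}\big),$$ and $t_k(\omega)=\inf\{n\in\mathbb{N}:\omega_n=k\}$, $\mathbb{N}=\{1,2,\dots\}$. Quantum Markov chain (QMC): for a unital $C^*$-algebra $M_0$ (here $B(\mathcal{H}\otimes\mathcal{K})$), the QMC associated with a state $\phi_0$ on $M_0$ and a completely positive unital map $\mathcal{E}:M_0\otimes M_0\to M_0$ is the state on $\bigotimes_{n\in\mathbb{Z}_+}M_0$ given by $$\varphi(x_0\otimes\cdots\otimes x_n)=\phi_0\big(\mathcal{E}(x_0\otimes\mathcal{E}(x_1\otimes\cdots\otimes\mathcal{E}(x_n\otimes\mathbf{1})\cdots))\big).$$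 A density operator $\rho$ is identified with the state $x\mapsto\mathrm{Tr}(\rho x)$. Recurrence: let $J_n$ be the embedding of $M_0$ into the $n$-th factor, $\beta$ the shift $\beta(a_0\otimes\cdots\otimes a_n)=\mathbf{1}\otimes a_0\otimes\cdots\otimes a_n$, and $J_0(e)\otimes x:=J_0(e)\beta(x)$. For a projection $e\in M_0$, with $e^\perp=\mathbf{1}-e$, put $\tau_0=J_0(e)$ and $\tau_n=J_0(e^\perp)\cdots J_{n-1}(e^\perp)J_n(e)$ for $n\ge1$. The projection $e$ is $\varphi$-recurrent if $\varphi(J_0(e))\ne0$ and $\frac{1}{\varphi(J_0(e))}\sum_{n\ge0}\varphi(J_0(e)\otimes\tau_n)=1$. *)

(* Defs.v *)
From HB Require Import structures.
From mathcomp Require Import all_boot all_order all_algebra finmap complex.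
From mathcomp Require Import all_classical all_reals all_analysis.
From mathcomp Require Import showcase.summability.

Set Implicit Arguments.
Unset Strict Implicit.
Unset Printing Implicit Defensive.

Import Order.TTheory GRing.Theory Num.Theory.
Import numFieldNormedType.Exports.

Local Open Scope classical_set_scope.
Local Open Scope ring_scope.

(* R[i] under a name: the normed topology that the library puts on every
   numClosedFieldType is not found by unification on R[i] itself. *)
Definition Cplx (R : realType) : numClosedFieldType := R[i].

Definition lspan (C : pzRingType) (V : lmodType C) (S : set V) : set V :=
  [set v | exists n (c : 'I_n -> C) (u : 'I_n -> V),
     (forall i, S (u i)) /\ v = \sum_(i < n) c i *: u i].

(* The inner product is linear in its first argument and conjugate-linear in
   the second one, which is the library's convention. *)
HB.mixin Record isHilbert (R : realType) V
    of CompleteNormedModule (Cplx R) V := {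
  inner : {dot V for (@Num.conj (Cplx R))} ;
  inner_norm : forall x : V, `|x| ^+ 2 = inner x x
}.

#[short(type="hilbertType")]
HB.structure Definition Hilbert (R : realType) :=
  { V of isHilbert R V & CompleteNormedModule (Cplx R) V }.

Definition is_onb (R : realType) (H : hilbertType R) (I : Type) (b : I -> H) :=
  [/\ forall i, inner (b i) (b i) = 1,
      forall i j, i <> j -> inner (b i) (b j) = 0
    & closure (lspan (range b)) = setT].

Section BoundedOperators.
Variables (R : realType) (H : hilbertType R).
Local Notation C := (Cplx R).

Definition bounded_op : {pred H -> H} :=
  [pred f | `[< linear f /\
     exists2 c : C, 0 <= c & forall x, `|f x| <= c * `|x| >]].

Lemma bounded_op_submod : submod_closed bounded_op.
Proof.
split.
  apply/asboolP; split; first by move=> a x y; rewrite /= scaler0 addr0.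
  by exists 0 => // x; rewrite normr0 mul0r.
move=> a f g /asboolP[lf [c c0 hc]] /asboolP[lg [d d0 hd]]; apply/asboolP; split.
  move=> b x y; rewrite /= !fctE lf lg !scalerDr !scalerA (mulrC a b).
  by rewrite -!scalerA !addrA; congr (_ + _); rewrite -!addrA; congr (_ + _);
     rewrite addrC.
exists (`|a| * c + d); first by rewrite addr_ge0 // mulr_ge0.
move=> x; rewrite mulrDl; apply: le_trans (ler_normD _ _) _.
by rewrite lerD // normrZ -mulrA ler_wpM2l.
Qed.

HB.instance Definition _ :=
  GRing.isSubmodClosed.Build C (H -> H) bounded_op bounded_op_submod.

Record bop := Bop { bop_fun :> H -> H ; bop_funP : bop_fun \in bounded_op }.

HB.instance Definition _ := [isSub for bop_fun].
HB.instance Definition _ := [Choice of bop by <:].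
HB.instance Definition _ := [SubChoice_isSubLmodule of bop by <:].

Lemma bop_ext (S T : bop) : S =1 T -> S = T.
Proof. by move=> ST; apply: val_inj; apply/funext. Qed.

Lemma bop_linear (T : bop) : linear T.
Proof. by have /asboolP[] := bop_funP T. Qed.

Lemma bop_bounded (T : bop) :
  exists2 c : C, 0 <= c & forall x, `|T x| <= c * `|x|.
Proof. by have /asboolP[] := bop_funP T. Qed.

Lemma bop_id_subproof : (id : H -> H) \in bounded_op.
Proof. by apply/asboolP; split=> //; exists 1 => // x; rewrite mul1r. Qed.

Lemma bop_comp_subproof (S T : bop) : (S \o T : H -> H) \in bounded_op.
Proof.
apply/asboolP; split; first by move=> a x y; rewrite /= !bop_linear.
have [[c c0 hc] [d d0 hd]] := (bop_bounded S, bop_bounded T).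
exists (c * d); first exact: mulr_ge0.
by move=> x; apply: le_trans (hc _) _; rewrite -mulrA ler_wpM2l.
Qed.

Definition bop_id := Bop bop_id_subproof.
Definition bop_comp S T := Bop (bop_comp_subproof S T).

Lemma bop_compA : associative bop_comp.
Proof. by move=> S T U; exact: bop_ext. Qed.
Lemma bop_comp1 : left_id bop_id bop_comp.
Proof. by move=> S; exact: bop_ext. Qed.
Lemma bop_comp1r : right_id bop_id bop_comp.
Proof. by move=> S; exact: bop_ext. Qed.
Lemma bop_compDl : left_distributive bop_comp +%R.
Proof. by move=> S T U; exact: bop_ext. Qed.
Lemma bop_compDr : right_distributive bop_comp +%R.
Proof.
move=> S T U; apply: bop_ext => x.
by have := bop_linear S 1 (T x) (U x); rewrite !scale1r.
Qed.

(* A zero Hilbert space is allowed, hence possibly 1 = 0 in this ring. *)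
HB.instance Definition _ := GRing.Zmodule_isPzRing.Build bop
  bop_compA bop_comp1 bop_comp1r bop_compDl bop_compDr.

(* By the Riesz representation theorem the set below is a singleton. *)
Definition adj (T : bop) : bop :=
  xget 0 [set S : bop | forall x y, inner (S x) y = inner x (T y)].

Definition is_projection (e : bop) := e * e = e /\ adj e = e.

Definition has_strong_sum (I : choiceType) (F : I -> bop) (S : bop) :=
  forall x : H, partial_sum (fun i => F i x) @ totally --> S x.

Lemma inner_CauchySchwarz (u v : H) : `|inner u v| <= `|u| * `|v|.
Proof.
rewrite -ler_sqr ?nnegrE ?mulr_ge0 //; have [->|v0] := eqVneq v 0.
  by rewrite linear0r !normr0 mulr0.
have nv : `|v| ^+ 2 != 0 by rewrite expf_neq0 // normr_eq0.
have [a aE] : exists a : C, inner u v = a * `|v| ^+ 2.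
  by exists (inner u v / `|v| ^+ 2); rewrite divfK.
have := exprn_ge0 2 (normr_ge0 (u - a *: v)); rewrite inner_norm.
rewrite linearBl /= !linearBr /= !linearZl_LR /= !linearZr_LR /=.
rewrite -!inner_norm (hermC _ v u) expr0 mul1r aE /GRing.scale /= aE.
rewrite opprB addrA subrK => ge0.
rewrite normCK exprMn -subr_ge0 (mulrAC a) -mulrBl.
by rewrite mulr_ge0 // exprn_ge0.
Qed.

Lemma ketbra_subproof (x y : H) : (fun v => inner v y *: x) \in bounded_op.
Proof.
apply/asboolP; split.
  by move=> a u v; rewrite linearDl /= linearZl_LR /= scalerDl scalerA.
exists (`|y| * `|x|); first exact: mulr_ge0.
move=> v; rewrite normrZ mulrAC ler_wpM2r // mulrC.
exact: inner_CauchySchwarz.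
Qed.

(* |x><y| *)
Definition ketbra (x y : H) := Bop (ketbra_subproof x y).

(* Some orthonormal basis, as a set of vectors indexed by itself.  For trace
   class operators the trace does not depend on this choice. *)
Definition some_onb : set H :=
  xget set0 [set E : set H | is_onb (fun e : E => val e)].

Definition diag_sum (T : bop) : {fset some_onb} -> C :=
  partial_sum (fun e : some_onb => inner (T (val e)) (val e)).

Definition Tr (T : bop) : C := lim (diag_sum T @ totally).

Definition positive_op (T : bop) := forall x, 0 <= inner (T x) x.

Definition is_density (p : bop) :=
  [/\ positive_op p, cvg (diag_sum p @ totally) & Tr p = 1].

End BoundedOperators.

Notation "''B' ( H )" := (bop H) (at level 8, format "''B' ( H )").

Section Tensor.
Variables (R : realType) (H K HK : hilbertType R).

(* HK is, through (u, v) |-> u (x) v, the Hilbert tensor product of H and K. *)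
Definition is_hilbert_tensor (tens : {bilinear H -> K -> HK}) :=
  (forall u u' v v',
     inner (tens u v) (tens u' v') = inner u u' * inner v v') /\
  closure (lspan [set w | exists u v, w = tens u v]) = setT.

Definition optens (tens : {bilinear H -> K -> HK}) (S : 'B(H)) (T : 'B(K)) :
    'B(HK) :=
  xget 0 [set U : 'B(HK) | forall u v, U (tens u v) = tens (S u) (T v)].

End Tensor.

(* Unital C*-algebras.  The norm is a field, instead of an instance of the
   normed modules of the library, because the hierarchy has no join between
   rings and normed modules below numDomainType. *)
HB.mixin Record isCStar (R : realType) A of GRing.Algebra (Cplx R) A := {
  star : A -> A ;
  starD : {morph star : x y / x + y} ;
  starZ : forall (c : Cplx R) x, star (c *: x) = Num.conj c *: star x ;
  starM : forall x y, star (x * y) = star y * star x ;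
  starK : involutive star ;
  cnorm : A -> Cplx R ;
  cnorm_eq0 : forall x, cnorm x = 0 -> x = 0 ;
  cnormD : forall x y, cnorm (x + y) <= cnorm x + cnorm y ;
  cnormZ : forall (c : Cplx R) x, cnorm (c *: x) = `|c| * cnorm x ;
  cnormM : forall x y, cnorm (x * y) <= cnorm x * cnorm y ;
  cnorm_star : forall x, cnorm (star x * x) = cnorm x ^+ 2 ;
  cnorm_complete : forall u : nat -> A,
    (forall e, 0 < e -> exists N, forall m n, (N <= m)%N -> (N <= n)%N ->
       cnorm (u m - u n) < e) ->
    exists l, forall e, 0 < e -> exists N, forall n, (N <= n)%N ->
       cnorm (u n - l) < e
}.

#[short(type="cstarType")]
HB.structure Definition CStar (R : realType) :=
  { A of isCStar R A & GRing.Algebra (Cplx R) A }.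

Section TensorPowers.
Variables (R : realType) (L : hilbertType R) (A : cstarType R).
Local Notation C := (Cplx R).

Definition is_star_rep (f : 'B(L) -> A) :=
  [/\ linear f, f 1 = 1, forall x y, f (x * y) = f x * f y
    & forall x, f (adj x) = star (f x)].

Variables (I : choiceType) (J : I -> 'B(L) -> A).

(* The product, over the sites i in s, of x i placed at site i. *)
Definition elem_tensor (s : seq I) (x : I -> 'B(L)) : A :=
  \prod_(i <- s) J i (x i).

(* A is the spatial C*-tensor product of copies of B(L) indexed by I, and J i
   is the embedding of the i-th factor.  The last clause says that the norm of
   T = \sum_l (x) _(i in s) x l i is its operator norm on the Hilbert tensor
   power of L over s: it reads |T xi|^2 <= c^2 |xi|^2 for all the
   xi = \sum_a (x) _(i in s) xi a i. *)
Definition is_spatial_tensor :=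
  [/\ forall i, is_star_rep (J i),
      forall i j x y, i <> j -> J i x * J j y = J j y * J i x,
      forall (a : A) (e : C), 0 < e ->
        exists2 b, lspan [set w | exists s x, uniq s /\ w = elem_tensor s x] b
                 & cnorm (a - b) < e
    & forall (s : seq I) n (x : 'I_n -> I -> 'B(L)) (c : C), uniq s -> 0 <= c ->
        cnorm (\sum_(l < n) elem_tensor s (x l)) <= c <->
        forall m (xi : 'I_m -> I -> L),
          \sum_(a < m) \sum_(l < n) \sum_(b < m) \sum_(r < n)
            \prod_(i <- s) inner (x l i (xi a i)) (x r i (xi b i))
          <= c ^+ 2 * \sum_(a < m) \sum_(b < m)
                        \prod_(i <- s) inner (xi a i) (xi b i)].

Definition is_state (phi : A -> C) :=
  [/\ scalar phi, forall a, 0 <= phi (star a * a) & phi 1 = 1].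

Definition is_cp_unital (E : A -> 'B(L)) :=
  [/\ linear E, E 1 = 1
    & forall n (a : 'I_n -> A) (xi : 'I_n -> L),
        0 <= \sum_(i < n) \sum_(j < n)
               inner (E (star (a i) * a j) (xi j)) (xi i)].

End TensorPowers.

(* M2 is M_0 (x) M_0 with embeddings J2 false and J2 true of its two factors,
   and M is the infinite tensor product of copies of M_0, where M_0 = B(L). *)
Section QuantumMarkovChain.
Variables (R : realType) (L : hilbertType R) (M2 M : cstarType R).
Variables (J2 : bool -> 'B(L) -> M2) (J : nat -> 'B(L) -> M).
Local Notation C := (Cplx R).

Definition tensor2 (x y : 'B(L)) : M2 := J2 false x * J2 true y.

Definition is_qmc (phi0 : 'B(L) -> C) (E : M2 -> 'B(L)) (phi : M -> C) :=
  is_state phi /\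
  forall (x : nat -> 'B(L)) n,
    phi (\prod_(i < n.+1) J i (x i)) =
    phi0 (foldr (fun a b => E (tensor2 a b)) 1 (mkseq x n.+1)).

Definition is_shift (beta : M -> M) :=
  [/\ linear beta, beta 1 = 1, forall a b, beta (a * b) = beta a * beta b,
      forall a, beta (star a) = star (beta a)
    & forall n x, beta (J n x) = J n.+1 x].

Definition tau (e : 'B(L)) (n : nat) : M :=
  (\prod_(i < n) J i (1 - e)) * J n e.

Definition recurrent (beta : M -> M) (phi : M -> C) (e : 'B(L)) :=
  phi (J 0%N e) != 0 /\
  (phi (J 0%N e))^-1 * \sum_(n < N) phi (J 0%N e * beta (tau e n))
    @[N --> \oo] --> (1 : C).

End QuantumMarkovChain.

(* Lambda^nat, remembering the initial site k, which makes it pointed. *)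
Definition paths (Lambda : Type) (k : Lambda) := nat -> Lambda.

HB.instance Definition _ (Lambda : choiceType) (k : Lambda) :=
  Choice.copy (paths k) (nat -> Lambda).
HB.instance Definition _ (Lambda : choiceType) (k : Lambda) :=
  isPointed.Build (paths k) (fun _ => k).

Definition cylinder (Lambda : choiceType) (k : Lambda) (s : seq Lambda) :
    set (paths k) :=
  [set w | mkseq w (size s) = s].
Arguments cylinder {Lambda} k s.

Definition path_space (Lambda : choiceType) (k : Lambda) :=
  g_sigma_algebraType (range (cylinder k)).

Definition hitting_time (R : realType) (Lambda : choiceType) (k : Lambda)
    (w : nat -> Lambda) : \bar R :=
  ereal_inf [set n%:R%:E | n in [set n : nat | (0 < n)%N /\ w n = k]].

Section OQRW.
Variables (R : realType) (Lambda : countType) (H K HK : hilbertType R).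
Local Notation C := (Cplx R).

(* B i j is B^i_j, the transition from site j to site i. *)
Variable B : Lambda -> Lambda -> 'B(H).

Definition is_oqrw :=
  forall j, has_strong_sum (fun i => adj (B i j) * B i j) 1.

(* B^{i_n}_{i_{n-1}} ... B^{i_1}_k for s = i_1, ..., i_n *)
Fixpoint path_op (k : Lambda) (s : seq Lambda) : 'B(H) :=
  if s is i :: s' then path_op i s' * B i k else 1.

Definition is_oqrw_law (p : 'B(H)) (k : Lambda)
    (P : probability (path_space k) R) :=
  P [set w | w 0%N = k] = 1%E /\
  forall s : seq Lambda,
    (fine (P (cylinder k (k :: s))))%:C%C =
    Tr (path_op k s * p * adj (path_op k s)) :> C.

Variables (tens : {bilinear H -> K -> HK}) (ket : Lambda -> K).

Definition oqrw_M (i j : Lambda) : 'B(HK) :=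
  optens tens (B i j) (ketbra (ket i) (ket j)).

Definition at_site (S : 'B(H)) (k : Lambda) : 'B(HK) :=
  optens tens S (ketbra (ket k) (ket k)).

Definition is_Et (p : 'B(H)) (M2 : cstarType R) (J2 : bool -> 'B(HK) -> M2)
    (E : M2 -> 'B(HK)) :=
  forall x y : 'B(HK),
    has_strong_sum
      (fun ij : Lambda * Lambda =>
         Tr (at_site p ij.2 * x) *:
           (adj (oqrw_M ij.1 ij.2) * y * oqrw_M ij.1 ij.2))
      (E (tensor2 J2 x y)).

End OQRW.

(* Main.v *)
Require Import Defs.
From mathcomp Require Import all_boot all_order all_algebra finmap complex.
From mathcomp Require Import all_classical all_reals all_analysis.
From mathcomp Require Import showcase.summability.
From mathcomp Require Import ring lra.

Set Implicit Arguments.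
Unset Strict Implicit.
Unset Printing Implicit Defensive.

Import Order.TTheory GRing.Theory Num.Theory.
Import numFieldNormedType.Exports.

Local Open Scope classical_set_scope.
Local Open Scope ring_scope.

(** Write e for the projection under study, e' = 1 - e, and A_x for the map
    y |-> Et (x (x) y).  The event of being in e at time 0 and in e' at the next
    n times has phi-value f n = phi0 (A_e (A_e' (... (A_e' 1)))).  As
    J_n e = 1 - J_n e', the n-th term of the recurrence series is
    f n - f (n + 1), so that the series telescopes and e is recurrent exactly
    when f 0 is nonzero and f n tends to 0 (lemma recurrentE).

    The transition map forgets everything about x except the numbers
    c_j(x) = Tr ((p (x) |j><j|) x): on a vector h (x) |j>, the quadratic form of
    A_x y is c_j(x) times the sum over i of the quadratic forms of y at
    B_ij h (x) |i> (lemma Et_ket).  For x = Q (x) |k><k| the weight c_j(x) is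
    q = Tr (p Q) if j = k and 0 otherwise, and for its complement it is 1 - q if
    j = k and 1 otherwise.

    (i) If q = 1, then A_e' multiplies by the indicator of j <> k, hence f n is
    the sum of the weights of the paths which leave k and stay away from it for
    n steps, that is P (w_1 <> k, ..., w_n <> k).  It decreases to
    P (t_k = oo), which vanishes exactly when t_k is almost surely finite.

    (ii) If q < 1, then for the projection 1 - Q (x) |k><k| the map A_e' has
    weights at most q, hence f n <= q ^ n, which tends to 0, while
    f 0 = 1 - q <> 0.

    Infinitely many sites occur and traces over infinite-dimensional spaces are
    limits, so sums have to be exchanged.  This is harmless once every quantity
    is a sum of nonnegative reals: a density operator is written as a countable
    sum of |v_n><v_n| (lemma density_mixture), and then Tr (p X) is the sum of
    the <X v_n, v_n> for positive X (lemma trace_formula), in any orthonormal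
    basis.  The identities above thus reduce to vectors, and the exchanges to
    the Fubini theorem for nonnegative families.  The underlying facts on
    adjoints rest on the Riesz representation theorem (lemma riesz). *)

(** * Real parts and limits of complex scalars *)

Section ComplexScalars.
Variable R : realType.
Local Notation C := (Cplx R).
Implicit Types (z w : C) (r : R).

Definition reC z : R := complex.Re z.
Definition toC r : C := r%:C%C.

Lemma reCD z w : reC (z + w) = reC z + reC w.
Proof. by case: z w => [a b] [c d]. Qed.
Lemma reCN z : reC (- z) = - reC z.
Proof. by case: z. Qed.
Lemma reCB z w : reC (z - w) = reC z - reC w.
Proof. by rewrite reCD reCN. Qed.
Lemma reC0 : reC 0 = 0. Proof. by []. Qed.
Lemma reC1 : reC 1 = 1. Proof. by []. Qed.
Lemma reC_sum I (s : seq I) (P : pred I) (F : I -> C) :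
  reC (\sum_(i <- s | P i) F i) = \sum_(i <- s | P i) reC (F i).
Proof. exact: (big_morph _ reCD reC0). Qed.
Lemma reC_conj z : reC (Num.conj z) = reC z.
Proof. by case: z. Qed.
Lemma toCK r : reC (toC r) = r. Proof. by []. Qed.
Lemma reCK z : 0 <= z -> toC (reC z) = z.
Proof. by case: z => a b; rewrite lecE /= => /andP[/eqP -> _]. Qed.
Lemma toC_ge0 r : (0 <= toC r) = (0 <= r).
Proof. exact: ler0c. Qed.
Lemma toC_gt0 r : (0 < toC r) = (0 < r).
Proof. exact: (ltcR 0 r). Qed.
Lemma toC_le r s : (toC r <= toC s) = (r <= s).
Proof. exact: lecR. Qed.
Lemma toC_lt r s : (toC r < toC s) = (r < s).
Proof. exact: ltcR. Qed.
Lemma toC0 : toC 0 = 0. Proof. by []. Qed.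
Lemma toC1 : toC 1 = 1. Proof. by []. Qed.
Lemma toCD r s : toC (r + s) = toC r + toC s.
Proof. exact: (rmorphD (@real_complex R)). Qed.
Lemma toCN r : toC (- r) = - toC r.
Proof. exact: (rmorphN (@real_complex R)). Qed.
Lemma toCB r s : toC (r - s) = toC r - toC s.
Proof. exact: (rmorphB (@real_complex R)). Qed.
Lemma toCM r s : toC (r * s) = toC r * toC s.
Proof. exact: (rmorphM (@real_complex R)). Qed.
Lemma toCV r : toC r^-1 = (toC r)^-1.
Proof. exact: (fmorphV (@real_complex R)). Qed.
Lemma toCX r n : toC (r ^+ n) = toC r ^+ n.
Proof. exact: (rmorphXn (@real_complex R)). Qed.
Lemma toC_nat n : toC n%:R = n%:R.
Proof. exact: (rmorph_nat (@real_complex R)). Qed.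
Lemma toC_conj r : Num.conj (toC r) = toC r.
Proof. exact: conjc_real. Qed.
Lemma toC_inj : injective toC.
Proof. exact: complexI. Qed.
Lemma reCZ r z : reC (toC r * z) = r * reC z.
Proof. by case: z => a b; rewrite /reC /toC /=; simpc. Qed.
Lemma reC_ge0 z : 0 <= z -> 0 <= reC z.
Proof. by move=> z0; rewrite -toC_ge0 reCK. Qed.
Lemma toC_norm r : `|toC r| = toC `|r|.
Proof. by rewrite /toC normc_def /= expr0n addr0 sqrtr_sqr. Qed.
Lemma reC_norm z : `|toC (reC z)| <= `|z|.
Proof. rewrite toC_norm; exact: normc_ge_Re. Qed.

Lemma cvg_reC T (F : set_system T) {FF : Filter F} (f : T -> C) (l : C) :
  f @ F --> l -> reC (f x) @[x --> F] --> reC l.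
Proof.
move=> fl; apply/cvgrPdist_lt => e e0.
have e0' : 0 < toC e by rewrite toC_gt0.
have /cvgrPdist_lt/(_ _ e0') := fl.
apply: filterS => x; rewrite -toC_lt -toC_norm -reCB; apply: le_lt_trans.
exact: reC_norm.
Qed.

Lemma cvg_toC T (F : set_system T) {FF : Filter F} (f : T -> R) (l : R) :
  f @ F --> l -> toC (f x) @[x --> F] --> toC l.
Proof.
move=> fl; apply/cvgrPdist_lt => e e0.
have e0' : 0 < reC e by rewrite -toC_gt0 reCK // ltW.
have /cvgrPdist_lt/(_ _ e0') := fl.
apply: filterS => x; rewrite -toC_lt reCK ?(ltW e0) // -toCB toC_norm; exact.
Qed.

Lemma cvgC_unique T (F : set_system T) {FF : ProperFilter F} (f : T -> C)
    (l l' : C) : f @ F --> l -> f @ F --> l' -> l = l'.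
Proof. by move=> fl fl'; apply: (cvg_unique (@norm_hausdorff _ C) fl fl'). Qed.

Lemma cvgC_cst T (F : set_system T) {FF : Filter F} (f : T -> C) (l : C) :
  (forall x, f x = l) -> f @ F --> l.
Proof.
move=> fl; apply/cvgrPdist_lt => e e0.
by apply: filterE => x; rewrite fl subrr normr0.
Qed.

Lemma cvgC_affine T (F : set_system T) {FF : Filter F} (f : T -> C) (a b l : C) :
  f @ F --> l -> a + b * f x @[x --> F] --> a + b * l.
Proof.
move=> fl; apply: cvgD; first exact: cvg_cst.
apply: cvgM; [exact: cvg_cst|exact: fl].
Qed.

End ComplexScalars.

(** * Inner products *)

Section InnerProduct.
Variables (R : realType) (H : hilbertType R).
Local Notation C := (Cplx R).
Implicit Types (x y z : H) (a : C).

Lemma innerDl x y z : inner (x + y) z = inner x z + inner y z.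
Proof. by rewrite linearDl. Qed.
Lemma innerZl a x y : inner (a *: x) y = a * inner x y.
Proof. by rewrite linearZl_LR. Qed.
Lemma innerNl x y : inner (- x) y = - inner x y.
Proof. by rewrite linearNl. Qed.
Lemma innerBl x y z : inner (x - y) z = inner x z - inner y z.
Proof. by rewrite linearBl. Qed.
Lemma innerDr x y z : inner x (y + z) = inner x y + inner x z.
Proof. by rewrite linearDr. Qed.
Lemma innerZr a x y : inner x (a *: y) = Num.conj a * inner x y.
Proof. by rewrite linearZr_LR. Qed.
Lemma innerNr x y : inner x (- y) = - inner x y.
Proof. by rewrite linearNr. Qed.
Lemma innerBr x y z : inner x (y - z) = inner x y - inner x z.
Proof. by rewrite linearBr. Qed.
Lemma inner0l x : inner (0 : H) x = 0.
Proof. by rewrite linear0l. Qed.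
Lemma inner0r x : inner x (0 : H) = 0.
Proof. by rewrite linear0r. Qed.
Lemma innerC x y : inner x y = Num.conj (inner y x).
Proof. by rewrite (hermC _ x y) expr0 mul1r. Qed.
Lemma inner_suml I (s : seq I) (F : I -> H) y :
  inner (\sum_(i <- s) F i) y = \sum_(i <- s) inner (F i) y.
Proof.
by elim: s => [|i s IH]; rewrite ?big_nil ?inner0l // !big_cons innerDl IH.
Qed.
Lemma inner_sumr I (s : seq I) (F : I -> H) y :
  inner y (\sum_(i <- s) F i) = \sum_(i <- s) inner y (F i).
Proof.
by elim: s => [|i s IH]; rewrite ?big_nil ?inner0r // !big_cons innerDr IH.
Qed.

(** The squared norm as a real number; the norm itself is complex-valued. *)
Definition sqn x : R := reC (inner x x).

Lemma inner_self_ge0 x : 0 <= inner x x.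
Proof. by rewrite -inner_norm exprn_ge0. Qed.
Lemma sqnE x : inner x x = toC (sqn x).
Proof. by rewrite reCK // inner_self_ge0. Qed.
Lemma sqn_ge0 x : 0 <= sqn x.
Proof. exact: reC_ge0 (inner_self_ge0 x). Qed.
Lemma norm_sqn x : `|x| ^+ 2 = toC (sqn x).
Proof. by rewrite inner_norm sqnE. Qed.
Lemma sqn_eq0 x : sqn x = 0 -> x = 0.
Proof.
move=> x0; apply/eqP; rewrite -normr_eq0 -sqrf_eq0 norm_sqn x0; exact: eqxx.
Qed.
Lemma inner_eqr x y : (forall z, inner z x = inner z y) -> x = y.
Proof.
move=> e; apply/eqP; rewrite -subr_eq0; apply/eqP/sqn_eq0.
by rewrite /sqn innerBr e subrr.
Qed.
Lemma inner_eql x y : (forall z, inner x z = inner y z) -> x = y.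
Proof. by move=> e; apply: inner_eqr => z; rewrite innerC e -innerC. Qed.

(** The squared modulus as a real number, so that sums of squared moduli can be
    taken in the extended reals. *)
Definition cnormsq (a : C) : R := reC (a * Num.conj a).
Lemma cnormsqE a : toC (cnormsq a) = `|a| ^+ 2.
Proof. by rewrite normCK reCK // mul_conjC_ge0. Qed.
Lemma cnormsq_ge0 a : 0 <= cnormsq a.
Proof. by rewrite -toC_ge0 cnormsqE exprn_ge0. Qed.
Lemma cnormsq_conj a : cnormsq (Num.conj a) = cnormsq a.
Proof. by rewrite /cnormsq conjCK mulrC. Qed.

Lemma sqnZ a x : sqn (a *: x) = cnormsq a * sqn x.
Proof. by apply: toC_inj; rewrite toCM -!norm_sqn cnormsqE normrZ exprMn. Qed.
Lemma sqnN x : sqn (- x) = sqn x.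
Proof. by rewrite /sqn innerNl innerNr opprK. Qed.
Lemma sqnD x y : sqn (x + y) = sqn x + sqn y + 2 * reC (inner x y).
Proof.
rewrite /sqn innerDl !innerDr !reCD [inner y x]innerC reC_conj; lra.
Qed.
Lemma sqnB x y : sqn (x - y) = sqn x + sqn y - 2 * reC (inner x y).
Proof. by rewrite sqnD sqnN innerNr reCN mulrN. Qed.

Lemma cvg_innerl T (F : set_system T) {FF : Filter F} (f : T -> H) l y :
  f @ F --> l -> inner (f x) y @[x --> F] --> inner l y.
Proof.
move=> fl; apply/cvgrPdist_lt => e e0.
have n0 : 0 < `|y| + 1 by rewrite ltr_wpDl.
have e0' : 0 < e / (`|y| + 1) by rewrite divr_gt0.
have /cvgrPdist_lt/(_ _ e0') := fl.
apply: filterS => x; rewrite -innerBl ltr_pdivlMr // => hx.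
apply: le_lt_trans hx; apply: le_trans (inner_CauchySchwarz _ _) _.
by rewrite ler_wpM2l // lerDl.
Qed.

End InnerProduct.

#[export] Existing Instance totally_filter.

(** * Unordered sums and orthonormal bases *)

Section UnorderedSums.
Variables (R : realType) (I : choiceType).
Implicit Types (f : I -> R) (A B : {fset I}).

Lemma partial_sumE (V : zmodType) (g : I -> V) A :
  partial_sum g A = \sum_(i <- A) g i.
Proof. by rewrite /partial_sum big_seq_fsetE. Qed.

Lemma partial_sum_le f A B : (forall i, 0 <= f i) -> fsubset A B ->
  partial_sum f A <= partial_sum f B.
Proof.
move=> f0 AB; rewrite !partial_sumE (big_fsetID _ (mem A) B) /=.
have -> : [fset x in B | x \in A]%fset = A.
  apply/fsetP => x; rewrite !inE /=; apply/andP/idP => [[]//|xA].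
  by split=> //; apply: (fsubsetP AB).
by rewrite lerDl sumr_ge0.
Qed.

Lemma partial_sum_fsbig f A :
  (\sum_(i \in [set` A]) (f i)%:E)%E = (partial_sum f A)%:E.
Proof. by rewrite fsbig_finite //= set_fsetK partial_sumE sumEFin. Qed.

Lemma partial_sum_le_esum f A :
  ((partial_sum f A)%:E <= \esum_(i in [set: I]) (f i)%:E)%E.
Proof.
apply: esum_ge; exists [set` A]; first by split.
by rewrite partial_sum_fsbig.
Qed.

Lemma esum_le_partial f (l : \bar R) :
  (forall A, (partial_sum f A)%:E <= l)%E ->
  (\esum_(i in [set: I]) (f i)%:E <= l)%E.
Proof.
move=> H; apply: ge_ereal_sup => _ [X [finX _] <-].
by have := H (fset_set X); rewrite -partial_sum_fsbig fset_setK.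
Qed.

Lemma cvg_totally_dist (K : numFieldType) (V : pseudoMetricNormedZmodType K)
    (g : {fset I} -> V) l (e : K) : g @ totally --> l -> 0 < e ->
  exists A, forall B, fsubset A B -> `|l - g B| < e.
Proof.
by move=> gl e0; case: ((cvgrPdist_lt g l).1 gl e e0) => A _ hA; exists A.
Qed.

(** Together with cvg_of_esum: for nonnegative families, convergence of the
    partial sums along finite sets is the same as having a finite supremum.
    This turns traces and strong sums of operators into extended real sums,
    which may be freely reordered. *)
Lemma esum_of_cvg f (l : R) : (forall i, 0 <= f i) ->
  partial_sum f @ totally --> l -> \esum_(i in [set: I]) (f i)%:E = l%:E.
Proof.
move=> f0 fl.
have ub A : partial_sum f A <= l.
  apply/ler_addgt0Pl => e e0.
  have [B HB] := cvg_totally_dist fl e0.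
  have h := HB (A `|` B)%fset (fsubsetUr A B).
  have := partial_sum_le f0 (fsubsetUl A B) => h2.
  move: h; rewrite ltr_norml => /andP[h _]; lra.
apply/eqP; rewrite eq_le; apply/andP; split.
  by apply: esum_le_partial => A; rewrite lee_fin.
apply/lee_addgt0Pr => e e0.
have [B HB] := cvg_totally_dist fl e0.
have h := HB B (fsubset_refl B).
apply: le_trans (leeD2r _ (partial_sum_le_esum _ B)).
rewrite -EFinD lee_fin; move: h; rewrite ltr_norml => /andP[_ h]; lra.
Qed.

Lemma cvg_of_esum f (l : R) : (forall i, 0 <= f i) ->
  \esum_(i in [set: I]) (f i)%:E = l%:E -> partial_sum f @ totally --> l.
Proof.
move=> f0 fl; apply/cvgrPdist_lt => e e0.
have [X [finX _] hX] : exists2 X : set I, fsets setT X &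
    ((l - e)%:E < \sum_(i \in X) (f i)%:E)%E.
  have : ((l - e)%:E < \esum_(i in [set: I]) (f i)%:E)%E.
    by rewrite fl lte_fin; lra.
  by case/ereal_sup_gt => _ [X fX <-] hX; exists X.
exists (fset_set X) => // B /= XB.
have := partial_sum_le_esum f B; rewrite fl lee_fin => h1.
have := partial_sum_le f0 XB => h2.
move: hX; rewrite -(fset_setK finX) partial_sum_fsbig lte_fin => h3.
rewrite ger0_norm; lra.
Qed.

End UnorderedSums.

Section OrthonormalBases.
Variables (R : realType) (H : hilbertType R).
Local Notation C := (Cplx R).

Lemma closure_sqn (S : set H) (x : H) (e : R) : closure S x -> 0 < e ->
  exists2 y, S y & sqn (x - y) < e.
Proof.
move=> Sx e0.
have s0 : 0 < Num.sqrt e by rewrite sqrtr_gt0.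
have s0' : 0 < toC (Num.sqrt e) by rewrite toC_gt0.
have [y [Sy xy]] := Sx _ (nbhsx_ballx x _ s0').
exists y => //; rewrite -toC_lt -norm_sqn.
move: xy; rewrite -ball_normE /= => xy.
have -> : toC e = toC (Num.sqrt e) ^+ 2.
  by rewrite expr2 -toCM -expr2 sqr_sqrtr ?ltW.
by rewrite ltr_sqr ?nnegrE ?(ltW s0').
Qed.

Variables (I : choiceType) (b : I -> H).
Hypothesis bP : is_onb b.

Lemma onb_inner i j : inner (b i) (b j) = (i == j)%:R.
Proof.
case: bP => b1 b0 _; have [->|/eqP] := eqVneq i j; first exact: b1.
exact: b0.
Qed.

Definition fproj (A : {fset I}) (x : H) : H := \sum_(i <- A) inner x (b i) *: b i.

Lemma fproj_inner A x i : i \in A -> inner (fproj A x) (b i) = inner x (b i).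
Proof.
move=> iA; rewrite inner_suml (big_fsetD1 i) //= innerZl onb_inner eqxx mulr1.
rewrite big1_fset ?addr0 // => j; rewrite !inE => /andP[ji _] _.
by rewrite innerZl onb_inner (negPf ji) mulr0.
Qed.

Lemma fproj_orth A x i : i \in A -> inner (x - fproj A x) (b i) = 0.
Proof. by move=> iA; rewrite innerBl fproj_inner // subrr. Qed.

(** The defect in the Bessel inequality is the squared distance from x to the
    span of the b i, i in A; the Parseval identity follows because that span
    comes arbitrarily close to x. *)
Lemma sqn_sub_fproj A x :
  sqn (x - fproj A x) = sqn x - partial_sum (fun i => cnormsq (inner x (b i))) A.
Proof.
have e : inner (x - fproj A x) (fproj A x) = 0.
  rewrite inner_sumr big1_seq // => i /andP[_ iA].
  by rewrite innerZr fproj_orth // mulr0.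
rewrite /sqn innerBr e subr0 innerBl reCB; congr (_ - _).
rewrite partial_sumE inner_suml reC_sum; apply: eq_bigr => i _.
by rewrite innerZl [inner (b i) x]innerC.
Qed.

Lemma bessel A x : partial_sum (fun i => cnormsq (inner x (b i))) A <= sqn x.
Proof. by rewrite -subr_ge0 -sqn_sub_fproj sqn_ge0. Qed.

Lemma lspan_fset (y : H) : lspan (range b) y ->
  exists (A : {fset I}) , forall z,
    (forall i, i \in A -> inner z (b i) = 0) -> inner z y = 0.
Proof.
move=> [n [c [u [bu ->]]]].
have /choice [g gE] : forall i, exists j, b j = u i.
  by move=> i; have [j _ <-] := bu i; exists j.
exists [fset g i | i in 'I_n]%fset => z zb.
rewrite inner_sumr big1 // => i _; rewrite innerZr -gE zb ?mulr0 //.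
exact: in_imfset.
Qed.

Lemma parseval x :
  \esum_(i in [set: I]) (cnormsq (inner x (b i)))%:E = (sqn x)%:E.
Proof.
have c0 i : 0 <= cnormsq (inner x (b i)) by exact: cnormsq_ge0.
apply/eqP; rewrite eq_le; apply/andP; split.
  by apply: esum_le_partial => A; rewrite lee_fin bessel.
apply/lee_addgt0Pr => e e0.
have xc : closure (lspan (range b)) x by case: bP => _ _ ->.
have [y /lspan_fset[A yA] xy] := closure_sqn xc e0.
apply: le_trans (leeD2r _ (partial_sum_le_esum _ A)).
rewrite -EFinD lee_fin -lerBlDl -sqn_sub_fproj.
(* z is orthogonal to the span, so it is not longer than x - y. *)
set z := x - fproj A x.
have zy : inner z y = 0 by apply: yA => i; exact: fproj_orth.
have zp : inner z (fproj A x) = 0.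
  rewrite inner_sumr big1_seq // => i /andP[_ iA].
  by rewrite innerZr fproj_orth // mulr0.
have ez : sqn z = reC (inner z (x - y)).
  by rewrite innerBr zy subr0 /sqn {2}/z innerBr zp subr0.
have := sqn_ge0 (z - (x - y)); rewrite sqnB -ez; lra.
Qed.

End OrthonormalBases.

(** * The Riesz representation theorem and adjoints *)

Section Riesz.
Variables (R : realType) (H : hilbertType R).
Local Notation C := (Cplx R).

Lemma norm_lt_sqn (x : H) (e : C) : 0 < e -> sqn x < reC e ^+ 2 -> `|x| < e.
Proof.
move=> e0 xe; rewrite -ltr_sqr ?nnegrE ?(ltW e0) // norm_sqn.
by rewrite -(reCK (ltW e0)) expr2 -toCM -expr2 toC_lt.
Qed.

Lemma complete_sqn (u : nat -> H) :
  (forall e : R, 0 < e -> exists N, forall n, (N <= n)%N -> sqn (u N - u n) < e) ->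
  cvg (u @ \oo).
Proof.
move=> uC; apply: cauchy_cvg; apply: cauchy_exP => e e0.
have r0 : 0 < reC e ^+ 2 by rewrite exprn_gt0 // -toC_gt0 reCK // ltW.
have [N hN] := uC _ r0; exists (u N); exists N => // n /= Nn.
by rewrite -ball_normE /=; apply: norm_lt_sqn => //; exact: hN.
Qed.

Lemma parallelogram (x y : H) :
  sqn (x - y) = 2 * sqn x + 2 * sqn y - sqn (x + y).
Proof. by rewrite sqnB sqnD; ring. Qed.

Lemma invS_lt (e : R) : 0 < e -> exists N, forall n, (N <= n)%N -> n.+1%:R^-1 < e.
Proof.
by move=> e0; have [N _ hN] := near_infty_natSinv_lt (PosNum e0); exists N.
Qed.

Variables (f : H -> C) (c : C).
Hypotheses (flin : scalar f) (c0 : 0 <= c) (fc : forall x, `|f x| <= c * `|x|).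

Let fZ a x : f (a *: x) = a * f x.
Proof.
have f00 : f 0 = 0.
  by apply/eqP; rewrite -normr_le0; apply: le_trans (fc 0) _; rewrite normr0 mulr0.
by rewrite -[a *: x]addr0 flin f00 addr0.
Qed.
Let fD x y : f (x + y) = f x + f y.
Proof. by rewrite -[x in f (x + _)]scale1r flin mul1r. Qed.
Let fB x y : f (x - y) = f x - f y.
Proof. by rewrite fD -scaleN1r fZ mulN1r. Qed.

(** A nonzero functional f is represented by a multiple of the vector x of
    minimal norm on the hyperplane f = 1: minimising sequences are Cauchy by the
    parallelogram law, and minimality makes x orthogonal to the kernel of f. *)
Lemma riesz : exists y, forall x, f x = inner x y.
Proof.
have [/existsNP[x1 /eqP fx1]|] := pselect (~ forall x, f x = 0); last first.
  by move/contrapT => fx0; exists 0 => x; rewrite fx0 inner0r.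
pose S := [set sqn x | x in [set x : H | f x = 1]].
have hS : has_inf S.
  split; last by exists 0 => _ [x _ <-]; exact: sqn_ge0.
  by exists (sqn ((f x1)^-1 *: x1)); exists ((f x1)^-1 *: x1) => //=; rewrite fZ mulVf.
pose d := inf S.
have dS x : f x = 1 -> d <= sqn x by move=> fx; apply: ge_inf; [case: hS|exists x].
have /choice[u uP] : forall n : nat, exists x, f x = 1 /\ sqn x < d + n.+1%:R^-1.
  move=> n; have n0 : 0 < n.+1%:R^-1 :> R by rewrite invr_gt0.
  by have [_ [x fx <-] xd] := inf_adherent n0 hS; exists x.
have u1 n : f (u n) = 1 by case: (uP n).
have ud n : sqn (u n) < d + n.+1%:R^-1 by case: (uP n).
have uC : cvg (u @ \oo).
  apply: complete_sqn => e e0.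
  have e40 : 0 < e / 4 by lra.
  have [N hN] := invS_lt e40; exists N => n Nn.
  rewrite parallelogram.
  have : 4 * d <= sqn (u N + u n).
    have -> : u N + u n = 2%:R *: (2%:R^-1 *: (u N + u n)).
      by rewrite scalerA divff ?scale1r // pnatr_eq0.
    rewrite sqnZ.
    have -> : cnormsq (2%:R : C) = 4.
      by apply: toC_inj; rewrite cnormsqE normr_nat -natrX toC_nat.
    rewrite ler_pM2l; last lra.
    by apply: dS; rewrite fZ fD !u1 -[1 + 1]/(2%:R) mulVf // pnatr_eq0.
  have := hN _ (leqnn N); have := hN _ Nn; have := ud N; have := ud n. 
  move: (n.+1%:R^-1) (N.+1%:R^-1) => a b; lra.
pose x := lim (u @ \oo).
have ux : u @ \oo --> x by [].
have fu : f (u n) @[n --> \oo] --> f x.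
  apply/cvgrPdist_lt => e e0.
  have c1 : 0 < c + 1 by rewrite ltr_wpDl.
  have e0' : 0 < e / (c + 1) by rewrite divr_gt0.
  have [N _ hN] := (cvgrPdist_lt u x).1 ux (e / (c + 1)) e0'.
  exists N => // n /hN /=.
  rewrite -fB ltr_pdivlMr // => hx; apply: le_lt_trans hx.
  by apply: (le_trans (fc _)); rewrite mulrC ler_wpM2l // lerDl.
have fx : f x = 1.
  exact: (cvgC_unique fu (cvgC_cst u1)).
have orth z : f z = 0 -> inner x z = 0.
  move=> fz.
  have [->|z0] := eqVneq z 0; first by rewrite inner0r.
  have sz0 : 0 < sqn z.
    by rewrite lt_neqAle sqn_ge0 andbT eq_sym; apply: contra_neq z0 => /sqn_eq0.
  have key n : cnormsq (inner (u n) z) <= sqn z * n.+1%:R^-1.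
    (* The t for which u n + t z is shortest on the line through u n. *)
    pose t : C := - (inner (u n) z / toC (sqn z)).
    have : d <= sqn (u n + t *: z) by apply: dS; rewrite fD fZ fz mulr0 addr0.
    rewrite sqnD sqnZ innerZr.
    have -> : Num.conj t * inner (u n) z = toC (- (cnormsq (inner (u n) z) / sqn z)).
      rewrite /t rmorphN rmorphM /= toCN toCM cnormsqE normCK.
      by rewrite -toCV toC_conj; ring.
    have -> : cnormsq t = cnormsq (inner (u n) z) / sqn z ^+ 2.
      apply: toC_inj; rewrite toCM !cnormsqE normrN normrM normfV exprMn exprVn.
      by rewrite toC_norm (ger0_norm (sqn_ge0 z)) toCV toCX.
    rewrite toCK => h; rewrite -ler_pdivrMl // [leLHS]mulrC.
    have e1 : cnormsq (inner (u n) z) / sqn z ^+ 2 * sqn z = cnormsq (inner (u n) z) / sqn z.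
      by field; rewrite gt_eqF.
    by move: h (ud n); rewrite e1; move: (_ / _) (n.+1%:R^-1) => q r; lra.
  have cz : inner (u n) z @[n --> \oo] --> inner x z by exact: cvg_innerl.
  apply: (cvgC_unique cz).
  apply/cvgrPdist_lt => e e0.
  have r0 : 0 < reC e ^+ 2 / sqn z.
    by rewrite divr_gt0 // exprn_gt0 // -toC_gt0 reCK // ltW.
  have [N hN] := invS_lt r0; exists N => // n /= Nn.
  rewrite sub0r normrN -ltr_sqr ?nnegrE ?(ltW e0) // -cnormsqE.
  rewrite -(reCK (ltW e0)) expr2 -toCM -expr2 toC_lt.
  apply: le_lt_trans (key n) _.
  by rewrite mulrC -ltr_pdivlMr //; exact: hN.
have x0 : inner x x != 0.
  apply/negP => /eqP xx0; have xE : x = 0 by apply: sqn_eq0; rewrite /sqn xx0.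
  have := fZ 0 x; rewrite scale0r mul0r -xE fx => /eqP; rewrite oner_eq0 //.
exists ((inner x x)^-1 *: x) => y.
have : inner (y - f y *: x) x = 0.
  by rewrite innerC orth ?rmorph0 // fB fZ fx mulr1 subrr.
rewrite innerBl innerZl => /eqP; rewrite subr_eq0 => /eqP yx.
rewrite innerZr yx rmorphV ?unitfE //= -innerC mulrCA mulVf ?mulr1 //.
Qed.

End Riesz.

Section Adjoint.
Variable R : realType.
Local Notation C := (Cplx R).

(** For maps between two different spaces: it also provides the adjoint of
    u |-> u (x) v, which is what operators on a tensor product are made of. *)
Lemma adjoint_exists (H K : hilbertType R) (T : H -> K) (c : C) :
    linear T -> 0 <= c -> (forall x, `|T x| <= c * `|x|) ->
  exists S : K -> H, [/\ linear S, forall x, `|S x| <= c * `|x|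
    & forall x y, inner (S x) y = inner x (T y)].
Proof.
move=> lT c0 Tc.
have TD : forall a x y, T (a *: x + y) = a *: T x + T y by exact: lT.
have /choice[S SP] : forall x, exists z, forall y, inner (T y) x = inner y z.
  move=> x; have b0 : 0 <= c * `|x| by rewrite mulr_ge0.
  apply: (riesz _ b0); first by move=> a u v; rewrite TD innerDl innerZl.
  move=> y; apply: le_trans (inner_CauchySchwarz _ _) _.
  by rewrite mulrAC ler_wpM2r.
have SE x y : inner (S x) y = inner x (T y) by rewrite innerC -SP -innerC.
exists S; split=> //.
  move=> a x y; apply: inner_eql => z.
  by rewrite innerDl innerZl !SE innerDl innerZl.
move=> x; have [->|Sx0] := eqVneq (S x) 0; first by rewrite normr0 mulr_ge0.
have n0 : 0 < `|S x| by rewrite normr_gt0.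
rewrite -(ler_pM2r n0) -expr2 inner_norm SE.
apply: le_trans (real_ler_norm _) _.
  by rewrite -SE ger0_real // inner_self_ge0.
apply: le_trans (inner_CauchySchwarz _ _) _.
by rewrite [c * _]mulrC -mulrA ler_wpM2l.
Qed.

Variable H : hilbertType R.
Implicit Types (S T : 'B(H)) (x y : H).

Lemma bopD T x y : T (x + y) = T x + T y.
Proof. by have := bop_linear T 1 x y; rewrite !scale1r. Qed.
Lemma bop0 T : T 0 = 0.
Proof. by apply: (addrI (T 0)); rewrite -bopD !addr0. Qed.
Lemma bopZ T (a : C) x : T (a *: x) = a *: T x.
Proof. by have := bop_linear T a x 0; rewrite bop0 !addr0. Qed.
Lemma bopN T x : T (- x) = - T x.
Proof. by rewrite -scaleN1r bopZ scaleN1r. Qed.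
Lemma bopB T x y : T (x - y) = T x - T y.
Proof. by rewrite bopD bopN. Qed.

Lemma adjP T x y : inner (adj T x) y = inner x (T y).
Proof.
have [c c0 Tc] := bop_bounded T.
have [S [lS Sc SE]] := adjoint_exists (@bop_linear _ _ T) c0 Tc.
have SB : S \in @bounded_op R H by apply/asboolP; split=> //; exists c.
have : exists U : 'B(H), forall x y, inner (U x) y = inner x (T y).
  by exists (Bop SB).
move=> /(@xgetPex _ 0 [set U : 'B(H) | forall x y, inner (U x) y = inner x (T y)]).
exact.
Qed.

Lemma bop_sqn T : exists2 c : R, 0 <= c & forall x, sqn (T x) <= c * sqn x.
Proof.
have [c c0 Tc] := bop_bounded T.
exists (reC c ^+ 2) => [|x]; first exact: sqr_ge0.
rewrite -toC_le toCM toCX -!norm_sqn reCK // -exprMn.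
by rewrite ler_sqr ?nnegrE ?mulr_ge0.
Qed.

End Adjoint.

(** The linear algebra behind positive_sym: h1 and h2 say that a sesquilinear
    form with diagonal values a, b and off-diagonal values s, t, of conjugates s'
    and t', is real at x + y and at x + i y. *)
Lemma polarisation_aux (F : fieldType) (a b s t s' t' i : F) :
  (2 : F) != 0 -> i != 0 -> a + s' + (t' + b) = a + s + (t + b) ->
  a + i * s' + (- i * t' + - i * (i * b)) = a + - i * s + (i * t + i * (- i * b)) ->
  s = t'.
Proof.
move=> n2 i0 h1 h2; apply: (mulfI n2).
have e1 : s + t = s' + t'.
  have -> : s + t = a + s + (t + b) - a - b by ring.
  by rewrite -h1; ring.
have e2 : s - t = t' - s'.
  apply: (mulfI i0).
  have -> : i * (s - t) = a - i * (i * b) - (a + - i * s + (i * t + i * (- i * b))).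
    by ring.
  by rewrite -h2; ring.
have -> : 2 * s = (s + t) + (s - t) by ring.
by rewrite e1 e2; ring.
Qed.

(** * Positive operators *)

Section PositiveOperators.
Variables (R : realType) (H : hilbertType R).
Local Notation C := (Cplx R).
Implicit Types (S T : 'B(H)) (x y : H).

Definition qf T x : R := reC (inner (T x) x).

Lemma pos_inner T x : positive_op T -> inner (T x) x = toC (qf T x).
Proof. by move=> T0; rewrite /qf reCK. Qed.

Lemma qf_ge0 T x : positive_op T -> 0 <= qf T x.
Proof. by move=> T0; exact: reC_ge0. Qed.

Lemma positive_sym T x y : positive_op T -> inner (T x) y = inner x (T y).
Proof.
move=> T0.
have re z : Num.conj (inner (T z) z) = inner (T z) z.
  by apply/CrealP; rewrite ger0_real.
have h1 := re (x + y); have h2 := re (x + 'i *: y).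
rewrite bopD !innerDl !innerDr !rmorphD /= !re in h1.
rewrite bopD bopZ !innerDl !innerDr !innerZl !innerZr !rmorphD !rmorphM /= !re in h2.
rewrite conjCK conjCi in h2.
rewrite (innerC x (T y)).
set s := inner (T x) y in h1 h2 *; set t := inner (T y) x in h1 h2 *.
set s' := Num.conj s in h1 h2; set t' := Num.conj t in h1 h2 *.
apply: (polarisation_aux _ _ h1 h2); first by rewrite pnatr_eq0.
exact: neq0Ci.
Qed.

Lemma qf0 T : qf T 0 = 0.
Proof. by rewrite /qf inner0r. Qed.

(** The Cauchy-Schwarz inequality for the semi-inner product <T x, y>, which may
    be degenerate. *)
Lemma positive_CS T x y : positive_op T ->
  cnormsq (inner (T x) y) <= qf T x * qf T y.
Proof.
move=> T0; set s := inner (T x) y.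
have key (r : R) : 0 <= qf T x - 2 * r * cnormsq s + r ^+ 2 * cnormsq s * qf T y.
  pose t : C := - (toC r * s).
  have := qf_ge0 (x + t *: y) T0; rewrite {1}/qf bopD bopZ !innerDl !innerDr.
  rewrite !innerZl !innerZr -/s (positive_sym y x T0) [inner y _]innerC -/s.
  rewrite (pos_inner x T0) (pos_inner y T0).
  have -> : t * Num.conj s = toC (- (r * cnormsq s)).
    by rewrite /t toCN toCM cnormsqE normCK; ring.
  have -> : Num.conj t * s = toC (- (r * cnormsq s)).
    by rewrite /t rmorphN rmorphM /= toC_conj toCN toCM cnormsqE normCK; ring.
  have -> : t * (Num.conj t * toC (qf T y)) = toC (r ^+ 2 * cnormsq s * qf T y).
    rewrite /t rmorphN rmorphM /= toC_conj 2!toCM toCX cnormsqE normCK; ring.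
  by rewrite -!toCD toCK; lra.
have y0 := qf_ge0 y T0; have s0 := cnormsq_ge0 s; have x0 := qf_ge0 x T0.
(* In the degenerate case the key inequality is affine in r and fails for
   large r unless s = 0; otherwise r = 1 / qf T y is optimal. *)
have [qy|qy] := eqVneq (qf T y) 0.
  rewrite qy mulr0; have [->//|sn0] := eqVneq (cnormsq s) 0.
  have := key ((qf T x + 1) / (2 * cnormsq s)); rewrite qy mulr0 addr0.
  have -> : 2 * ((qf T x + 1) / (2 * cnormsq s)) * cnormsq s = qf T x + 1 by field.
  by lra.
have yp : 0 < qf T y by rewrite lt_neqAle eq_sym qy.
have := key (qf T y)^-1.
have -> : qf T x - 2 * (qf T y)^-1 * cnormsq s + (qf T y)^-1 ^+ 2 * cnormsq s * qf T y =
   qf T x - cnormsq s / qf T y by field.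
by rewrite subr_ge0 ler_pdivrMr.
Qed.

Lemma qf_le T : exists2 c : R, 0 <= c & forall x, qf T x <= c * sqn x.
Proof.
have [c c0 Tc] := bop_sqn T; exists (c + 1) => [|x]; first by lra.
have := sqn_ge0 (T x - x); rewrite sqnB -/(qf T x).
by have := Tc x; have := sqn_ge0 x; rewrite mulrDl mul1r; nra.
Qed.

End PositiveOperators.

(** * Sums of nonnegative extended reals *)

Section EsumTools.
Variable R : realType.
Local Open Scope ereal_scope.

Lemma esumZ_le (I : choiceType) (D : set I) (c : R) (f : I -> \bar R) : (0 < c)%R ->
  (forall i, 0 <= f i) ->
  \esum_(i in D) (c%:E * f i) <= c%:E * \esum_(i in D) f i.
Proof.
move=> c0 f0; apply: ge_ereal_sup => _ [X XD <-].
rewrite -ge0_mule_fsumr // lee_pmul2l // ?lte_fin //.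
by apply: ereal_sup_ubound; exists X.
Qed.

Lemma esumZ (I : choiceType) (D : set I) (c : R) (f : I -> \bar R) : (0 <= c)%R ->
  (forall i, 0 <= f i) ->
  \esum_(i in D) (c%:E * f i) = c%:E * \esum_(i in D) f i.
Proof.
rewrite le_eqVlt => /predU1P[<-|c0] f0.
  by rewrite mul0e esum1 // => i _; rewrite mul0e.
apply/eqP; rewrite eq_le esumZ_le //= muleC -lee_pdivlMr // muleC.
have ci : (0 < c^-1)%R by rewrite invr_gt0.
have cf i : 0 <= c%:E * f i by rewrite mule_ge0 // lee_fin ltW.
apply: le_trans (esumZ_le D ci cf); apply: le_esum => i _.
by rewrite muleA -EFinM mulVf ?gt_eqF // mul1e.
Qed.

Lemma esum_swap (I J : choiceType) (a : I -> J -> \bar R) :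
  (forall i j, 0 <= a i j) ->
  \esum_(i in [set: I]) \esum_(j in [set: J]) a i j =
  \esum_(j in [set: J]) \esum_(i in [set: I]) a i j.
Proof.
move=> a0; rewrite esum_esum // [RHS]esum_esum; last by move=> *; exact: a0.
rewrite (@reindex_esum _ _ _ setT _ (fun ij : I * J => (ij.2, ij.1))) /=.
  by apply: congr2; [apply/seteqP; split|].
split=> //; first by move=> [i j] [i' j'] _ _ /= [-> ->].
by move=> [j i] _; exists (i, j).
Qed.

Lemma esum_pairE (I J : choiceType) (a : I * J -> \bar R) : (forall ij, 0 <= a ij) ->
  \esum_(ij in [set: I * J]) a ij =
  \esum_(j in [set: J]) \esum_(i in [set: I]) a (i, j).
Proof.
move=> a0; rewrite -(esum_swap (a := fun i j => a (i, j))) // esum_esum //.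
have -> : [set: I] `*`` (fun=> [set: J]) = [set: I * J] by apply/seteqP; split.
by apply: eq_esum => -[].
Qed.

Lemma esum_only (I : choiceType) (j : I) (a : I -> \bar R) : 0 <= a j ->
  (forall i, i <> j -> a i = 0) -> \esum_(i in [set: I]) a i = a j.
Proof.
move=> a0 aj; rewrite -[RHS](@esum_set1 _ _ j a a0) [RHS]esum_mkcond.
apply: eq_esum => i _; case: ifPn => //; rewrite notin_setE => ij; exact: aj.
Qed.

Lemma fin_of_lt (x : \bar R) : 0 <= x -> x < +oo -> x = (fine x)%:E.
Proof. by move=> x0 xoo; rewrite fineK // ge0_fin_numE. Qed.

Lemma esum_fin_le (I : choiceType) (D : set I) (f g : I -> \bar R) :
  (forall i, f i <= g i) -> \esum_(i in D) g i < +oo -> \esum_(i in D) f i < +oo.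
Proof. by move=> fg; apply: le_lt_trans; apply: le_esum. Qed.

End EsumTools.

(** * Traces of mixtures of vector states *)

Section TraceFormula.
Variables (R : realType) (H : hilbertType R).
Local Notation C := (Cplx R).
Implicit Types (S T X : 'B(H)) (x y : H).

(** T is the sum of the rank-one operators |v_i><v_i|, as a quadratic form. *)
Definition mixture (I : choiceType) T (v : I -> H) :=
  [/\ positive_op T,
      forall x, (qf T x)%:E = \esum_(i in [set: I]) (cnormsq (inner x (v i)))%:E
    & (\esum_(i in [set: I]) (sqn (v i))%:E < +oo)%E].

Definition mix_mean (I : choiceType) (v : I -> H) X : \bar R :=
  \esum_(i in [set: I]) (qf X (v i))%:E.

Lemma polarisation T x y : positive_op T ->
  4 * inner (T x) y = toC (qf T (x + y)) - toC (qf T (x - y)) +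
    'i * (toC (qf T (x + 'i *: y)) - toC (qf T (x - 'i *: y))).
Proof.
move=> T0; rewrite -!pos_inner // !bopD !bopN !bopZ.
rewrite !(innerDl, innerDr, innerNl, innerNr, innerZl, innerZr) conjCi.
have i2 : 'i * 'i = -1 :> C by rewrite -expr2 sqrCi.
move: (inner (T x) x) (inner (T y) y) (inner (T x) y) (inner (T y) x).
move: i2; move: ('i) => i i2 a b s t.
have -> : 4 * s = 2 * (s + t) - 2 * (i * i) * s + 2 * (i * i) * t.
  by rewrite i2; ring.
ring.
Qed.

Hypothesis onbH : is_onb (fun e : @some_onb R H => val e).

Lemma mix_mean_ge0 (I : choiceType) (v : I -> H) X : positive_op X ->
  (0 <= mix_mean v X)%E.
Proof. by move=> X0; apply: esum_ge0 => i _; rewrite lee_fin qf_ge0. Qed.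

Lemma mix_mean_fin (I : choiceType) (v : I -> H) X :
  (\esum_(i in [set: I]) (sqn (v i))%:E < +oo)%E -> (mix_mean v X < +oo)%E.
Proof.
move=> vfin; have [c c0 Xc] := qf_le X.
apply: (@le_lt_trans _ _ (c%:E * \esum_(i in [set: I]) (sqn (v i))%:E)%E).
  rewrite -esumZ // => [|i]; last by rewrite lee_fin sqn_ge0.
  by apply: le_esum => i _; rewrite -EFinM lee_fin.
by apply: lte_mul_pinfty => //; rewrite lee_fin.
Qed.

(** The diagonal terms <T X e, e> are not nonnegative, but polarisation writes
    them as combinations of qf T (X e + u e) for u in {1, -1, i, -i}.  For
    |u| = 1 the sum over e of these is, by Fubini and Parseval, the sum over n of
    the squared norms of X v_n + u^* v_n.  In the combination of the four sums
    the squares cancel, and only the terms <X v_n, v_n> survive. *)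
Lemma trace_cvg (I : choiceType) T (v : I -> H) X : mixture T v -> positive_op X ->
  diag_sum (T * X) @ totally --> toC (fine (mix_mean v X)).
Proof.
move=> [T0 Tv vfin] X0.
pose a i := (sqn (X (v i)) + sqn (v i))%:E.
have a0 i : (0 <= a i)%E by rewrite lee_fin addr_ge0 // sqn_ge0.
have [c c0 Xc] := bop_sqn X.
have afin : (\esum_(i in [set: I]) a i < +oo)%E.
  apply: (@le_lt_trans _ _ ((c + 1)%:E * \esum_(i in [set: I]) (sqn (v i))%:E)%E).
    rewrite -esumZ // => [||i]; [|lra|by rewrite lee_fin sqn_ge0].
    by apply: le_esum => i _; rewrite -EFinM lee_fin mulrDl mul1r lerD.
  apply: lte_mul_pinfty => //; rewrite ?lee_fin; lra.
pose s u := (\esum_(i in [set: I]) (sqn (X (v i) + Num.conj u *: v i))%:E)%E.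
have fs u : \esum_(e in [set: @some_onb R H]) (qf T (X (val e) + u *: val e))%:E = s u.
  under eq_esum do rewrite Tv.
  rewrite esum_swap; last by move=> *; rewrite lee_fin cnormsq_ge0.
  apply: eq_esum => i _; rewrite -(parseval onbH); apply: eq_esum => e _.
  rewrite innerDl innerZl positive_sym // -(conjCK u) -innerZr -innerDr conjCK.
  by rewrite innerC cnormsq_conj.
(* X being positive, only the real part of u matters, whence s i = s (- i). *)
have sE u : Num.conj u * u = 1 ->
    s u = (\esum_(i in [set: I]) (a i + (2 * reC (u * inner (X (v i)) (v i)))%:E))%E.
  move=> u1; apply: eq_esum => i _; rewrite sqnD sqnZ innerZr conjCK.
  by rewrite /cnormsq conjCK u1 reC1 mul1r -EFinD.
have sle u : Num.conj u * u = 1 -> (s u < +oo)%E.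
  move=> u1; apply: (esum_fin_le (g := fun i => (2%:E * a i)%E)); last first.
    by rewrite esumZ //; apply: lte_mul_pinfty.
  move=> i; rewrite -EFinM lee_fin.
  have := sqn_ge0 (X (v i) - Num.conj u *: v i); rewrite sqnB sqnD sqnZ.
  by rewrite /cnormsq conjCK u1 reC1 mul1r; lra.
have s0 u : (0 <= s u)%E by apply: esum_ge0 => i _; rewrite lee_fin sqn_ge0.
have scvg u : Num.conj u * u = 1 ->
    partial_sum (fun e : @some_onb R H => qf T (X (val e) + u *: val e)) @ totally
      --> fine (s u).
  move=> u1; apply: cvg_of_esum; first by move=> e; exact: qf_ge0.
  by rewrite fs -fin_of_lt // sle.
have u1 : Num.conj (1 : C) * 1 = 1 by rewrite rmorph1 mulr1.
have um1 : Num.conj (-1 : C) * -1 = 1 by rewrite rmorphN rmorph1 mulrN1 opprK.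
have ui : Num.conj ('i : C) * 'i = 1 by rewrite conjCi mulNr -expr2 sqrCi opprK.
have umi : Num.conj (- 'i : C) * - 'i = 1.
  by rewrite rmorphN /= conjCi opprK mulrN -expr2 sqrCi opprK.
have si : s 'i = s (- 'i).
  rewrite !sE //; apply: eq_esum => i _; rewrite pos_inner //.
  have -> : reC ('i * toC (qf X (v i))) = 0.
    by rewrite mulrC reCZ -complexiE /= mulr0.
  have -> // : reC (- 'i * toC (qf X (v i))) = 0.
  by rewrite mulNr reCN mulrC reCZ -complexiE /= mulr0 oppr0.
have s1 : s 1 = (s (-1)%R + 4%:E * mix_mean v X)%E.
  rewrite /mix_mean -esumZ // => [|i]; last by rewrite lee_fin qf_ge0.
  rewrite -esumD => [|i _|i _]; last 2 first.
  - by rewrite lee_fin sqn_ge0.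
  - by rewrite -EFinM lee_fin mulr_ge0 // qf_ge0.
  apply: eq_esum => i _; rewrite -EFinM -EFinD; congr (_%:E).
  have -> : Num.conj (1 : C) = 1 by rewrite rmorph1.
  have -> : Num.conj (-1 : C) = -1 by rewrite rmorphN rmorph1.
  rewrite scaleN1r scale1r sqnD sqnB -/(qf X (v i)); ring.
have f1 := fin_of_lt (s0 _) (sle _ u1); have fm1 := fin_of_lt (s0 _) (sle _ um1).
have fq := fin_of_lt (mix_mean_ge0 v X0) (mix_mean_fin X vfin).
have s1r : fine (s 1) = fine (s (-1)) + 4 * fine (mix_mean v X).
  by apply: EFin_inj; rewrite -f1 s1 {1}fm1 {1}fq.
pose ps (u : C) (A : {fset (@some_onb R H)}) : C :=
  toC (partial_sum (fun e : @some_onb R H => qf T (X (val e) + u *: val e)) A).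
have psE A : diag_sum (T * X) A =
    4^-1 * (ps 1 A - ps (-1) A + 'i * (ps 'i A - ps (- 'i) A)).
  rewrite /diag_sum /ps /= !partial_sumE.
  have ts (f : @some_onb R H -> R) : toC (\sum_(i <- A) f i) = \sum_(i <- A) toC (f i).
    exact: (rmorph_sum (@real_complex R)).
  rewrite !ts -!sumrB mulr_sumr -big_split /= mulr_sumr; apply: eq_bigr => e _.
  apply: (@mulfI _ 4); first by rewrite pnatr_eq0.
  rewrite mulrA mulfV ?pnatr_eq0 // mul1r scale1r scaleN1r scaleNr.
  exact: polarisation.
have cps u : Num.conj u * u = 1 -> ps u @ totally --> toC (fine (s u)).
  by move=> uu; apply: cvg_toC; exact: scvg.
have -> : toC (fine (mix_mean v X)) =
   4^-1 * (toC (fine (s 1)) - toC (fine (s (-1))) +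
    'i * (toC (fine (s 'i)) - toC (fine (s (- 'i))))).
  rewrite si subrr mulr0 addr0 s1r toCD addrAC subrr add0r toCM toC_nat mulrA.
  by rewrite mulVf ?mul1r // pnatr_eq0.
have -> : diag_sum (T * X) =
    fun A => 4^-1 * (ps 1 A - ps (-1) A + 'i * (ps 'i A - ps (- 'i) A)).
  by apply/funext => A; exact: psE.
apply: cvgM; first exact: cvg_cst.
apply: cvgD; first exact: cvgB (cps _ u1) (cps _ um1).
apply: cvgM; first exact: cvg_cst.
exact: cvgB (cps _ ui) (cps _ umi).
Qed.

Lemma trace_formula (I : choiceType) T (v : I -> H) X : mixture T v -> positive_op X ->
  Tr (T * X) = toC (fine (mix_mean v X)).
Proof.
by move=> Tv X0; apply: cvg_lim; [exact: norm_hausdorff|exact: trace_cvg].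
Qed.

End TraceFormula.

(** * Density operators as mixtures of vector states *)

Section Support.
Variables (R : realType) (E : choiceType).

(** The support of a summable family is countable: it is covered by finite sets
    A n whose partial sums are within 1/(n+1) of the total. *)
Lemma summable_enum (f : E -> R) (l : R) : (forall i, 0 <= f i) ->
  \esum_(i in [set: E]) (f i)%:E = l%:E ->
  exists e : nat -> option E, forall i, f i != 0 -> exists n, e n = Some i.
Proof.
move=> f0 fl.
have /choice[A AP] : forall n : nat, exists A : {fset E}, l - n.+1%:R^-1 < partial_sum f A.
  move=> n.
  have : ((l - n.+1%:R^-1)%:E < \esum_(i in [set: E]) (f i)%:E)%E.
    by rewrite fl lte_fin ltrBlDr ltrDl invr_gt0.
  case/ereal_sup_gt => _ [X [finX _] <-] hX; exists (fset_set X).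
  by move: hX; rewrite -{1}(fset_setK finX) partial_sum_fsbig lte_fin.
exists (fun k => if @choice.unpickle (nat * nat)%type k is Some (n, m)
  then onth (enum_fset (A n)) m else None).
move=> i fi0; apply: contrapT => ni.
have iA n : i \notin A n.
  apply/negP => iA; apply: ni; exists (choice.pickle (n, index i (A n))).
  by rewrite choice.pickleK onthE (nth_map i) ?index_mem // nth_index.
have fi : 0 < f i by rewrite lt_neqAle eq_sym fi0 f0.
have [N hN] := invS_lt fi.
have := partial_sum_le_esum f (i |` A N)%fset; rewrite fl lee_fin.
rewrite partial_sumE big_fsetU1 //= -partial_sumE.
have := AP N; have := hN N (leqnn N); move: (N.+1%:R^-1) => r; lra.
Qed.

End Support.

Section DensityDecomposition.
Variables (R : realType) (H : hilbertType R).
Local Notation C := (Cplx R).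
Implicit Types (S T X : 'B(H)) (x y : H).

(** The chosen basis is the empty set when no basis exists, and then all traces
    are 0.  A single nonzero trace therefore shows that it is a basis. *)
Lemma some_onbP T : Tr T != 0 -> is_onb (fun e : @some_onb R H => val e).
Proof.
move=> trT.
have [h|h] := pselect (exists E : set H, is_onb (fun e : E => val e)).
  exact: (xgetPex (set0 : set H) h).
exfalso; move/eqP: trT; apply.
have E0 : @some_onb R H = set0 by apply: xgetPN => E hE; apply: h; exists E.
have nE (e : @some_onb R H) : False.
  have ne : forall x, ~ @some_onb R H x by rewrite E0 => x [].
  exact: ne (set_valP e).
apply: cvg_lim; first exact: norm_hausdorff.
apply: cvgC_cst => A; rewrite /diag_sum partial_sumE big1 // => e.
Qed.

Lemma qf_eq0 T x : positive_op T -> qf T x = 0 -> T x = 0.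
Proof.
move=> T0 qx; apply: sqn_eq0; have := positive_CS x (T x) T0.
rewrite qx mul0r sqnE /cnormsq toC_conj -toCM toCK => h.
apply/eqP; rewrite -sqrf_eq0 expr2 eq_le h /= -expr2; exact: sqr_ge0.
Qed.

(** One step of a Cholesky decomposition: the largest multiple of |T e><T e|
    that leaves T positive is removed, which makes e a kernel vector.  If
    <T e, e> = 0 then T e = 0 already, and the convention 0^-1 = 0 makes the step
    trivial. *)
Definition peel T (e : H) : 'B(H) := T - toC (qf T e)^-1 *: ketbra (T e) (T e).

Lemma peelE T e x : peel T e x = T x - (toC (qf T e)^-1 * inner x (T e)) *: T e.
Proof. by rewrite -scalerA. Qed.

Lemma inner_peel T e x : positive_op T ->
  inner (peel T e x) x = toC (qf T x - (qf T e)^-1 * cnormsq (inner x (T e))).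
Proof.
move=> T0; rewrite peelE innerBl innerZl pos_inner // toCB toCM cnormsqE normCK.
by rewrite [inner (T e) x]innerC mulrA.
Qed.

Lemma qf_peel T e x : positive_op T ->
  qf (peel T e) x = qf T x - (qf T e)^-1 * cnormsq (inner x (T e)).
Proof. by move=> T0; rewrite {1}/qf inner_peel. Qed.

Lemma peel_pos T e : positive_op T -> positive_op (peel T e).
Proof.
move=> T0 x; rewrite inner_peel // toC_ge0 subr_ge0.
have [->|qe] := eqVneq (qf T e) 0; first by rewrite invr0 mul0r qf_ge0.
have qp : 0 < qf T e by rewrite lt_neqAle eq_sym qe qf_ge0.
rewrite mulrC ler_pdivrMr //; have := positive_CS e x T0.
by rewrite [inner (T e) x]innerC cnormsq_conj mulrC.
Qed.

Lemma peel_self T e : positive_op T -> peel T e e = 0.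
Proof.
move=> T0; rewrite peelE innerC pos_inner // toC_conj -toCM.
have [q0|q0] := eqVneq (qf T e) 0; first by rewrite qf_eq0 // scaler0 subrr.
by rewrite mulVf // toC1 scale1r subrr.
Qed.

Lemma peel_ker T e x : positive_op T -> T x = 0 -> peel T e x = 0.
Proof.
move=> T0 Tx; rewrite peelE Tx -positive_sym // Tx inner0l mulr0 scale0r subrr.
by [].
Qed.

Lemma qf_peel_le T e x : positive_op T -> qf (peel T e) x <= qf T x.
Proof.
by move=> T0; rewrite qf_peel // gerBl mulr_ge0 ?cnormsq_ge0 // invr_ge0 qf_ge0.
Qed.

Section Peeling.
Variables (p : 'B(H)) (e : nat -> H).
Hypothesis p0 : positive_op p.

Fixpoint residue n : 'B(H) := if n is m.+1 then peel (residue m) (e m) else p.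

Definition peeled n : H :=
  toC (Num.sqrt (qf (residue n) (e n))^-1) *: residue n (e n).

Lemma residue_pos n : positive_op (residue n).
Proof. by elim: n => //= n IH; exact: peel_pos. Qed.

Lemma residue_le n x : qf (residue n) x <= qf p x.
Proof.
by elim: n => //= n IH; apply: le_trans IH; apply/qf_peel_le/residue_pos.
Qed.

Lemma residue_ker m n : (m < n)%N -> residue n (e m) = 0.
Proof.
elim: n => //= n IH; rewrite ltnS leq_eqVlt => /predU1P[->|mn].
  exact/peel_self/residue_pos.
by apply: peel_ker; [exact: residue_pos|exact: IH].
Qed.

Lemma peeledE n x : cnormsq (inner x (peeled n)) =
  (qf (residue n) (e n))^-1 * cnormsq (inner x (residue n (e n))).
Proof.
have q0 : 0 <= (qf (residue n) (e n))^-1.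
  by rewrite invr_ge0; apply/qf_ge0/residue_pos.
apply: toC_inj; rewrite toCM !cnormsqE innerZr normrM exprMn toC_conj toC_norm.
by rewrite (ger0_norm (sqrtr_ge0 _)) -toCX sqr_sqrtr.
Qed.

Lemma residue_sum n x :
  qf p x - qf (residue n) x = \sum_(0 <= m < n) cnormsq (inner x (peeled m)).
Proof.
elim: n => [|n IH]; first by rewrite big_geq ?subrr.
rewrite big_nat_recr //= -IH peeledE qf_peel; last exact: residue_pos.
by ring.
Qed.

Definition exhausted x := exists N, forall n, (N <= n)%N -> residue n x = 0.

Lemma exhausted_lspan (I : Type) (b : I -> H) y :
  (forall i, exhausted (b i)) -> lspan (range b) y -> exhausted y.
Proof.
move=> bE [n [c [u [ub ->]]]]; elim/big_ind : _.
- by exists 0%N => n' _; exact: bop0.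
- move=> x1 x2 [N1 h1] [N2 h2]; exists (maxn N1 N2) => n'.
  by rewrite geq_max => /andP[l1 l2]; rewrite bopD h1 // h2 // addr0.
- move=> i _; have [j _ <-] := ub i; have [N hN] := bE j.
  by exists N => n' Nn; rewrite bopZ hN // scaler0.
Qed.

(** The residue kills each vector of the span of b after finitely many steps; the
    other vectors are approximated by these, uniformly in n since the residue
    stays below p. *)
Lemma residue_vanish (I : choiceType) (b : I -> H) x : is_onb b ->
  (forall i, exhausted (b i)) ->
  qf (residue n) x @[n --> \oo] --> (0 : R).
Proof.
move=> bP bE; apply/cvgrPdist_lt => eps eps0.
have [c c0 pc] := qf_le p.
have d0 : 0 < eps / (c + 1) by apply: divr_gt0 => //; lra.
have xc : closure (lspan (range b)) x by case: bP => _ _ ->.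
have [y yS xy] := closure_sqn xc d0.
have [N hN] := exhausted_lspan bE yS; exists N => // n /= Nn.
have rp := residue_pos n.
have -> : qf (residue n) x = qf (residue n) (x - y).
  rewrite /qf bopB hN // subr0 innerBr [X in _ - X]positive_sym //.
  by rewrite hN // inner0r subr0.
rewrite sub0r normrN ger0_norm ?qf_ge0 //.
apply: le_lt_trans (residue_le n _) _; apply: le_lt_trans (pc _) _.
move: xy; rewrite ltr_pdivlMr; last lra.
have := sqn_ge0 (x - y); nra.
Qed.

Lemma peeled_sum (I : choiceType) (b : I -> H) x : is_onb b ->
  (forall i, exhausted (b i)) ->
  (qf p x)%:E = \esum_(n in [set: nat]) (cnormsq (inner x (peeled n)))%:E.
Proof.
move=> bP bE; rewrite -nneseries_esumT => [|n]; last by rewrite lee_fin cnormsq_ge0.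
apply/esym/cvg_lim; first exact: ereal_hausdorff.
under eq_fun do rewrite sumEFin -residue_sum.
apply: cvg_EFin; first exact: nearW.
rewrite -[X in _ --> X]subr0; apply: cvgB; first exact: cvg_cst.
exact: residue_vanish bP bE.
Qed.

End Peeling.

(** Only countably many basis vectors b have <p b, b> <> 0; peeling p along them
    exhausts the whole basis, since the others are in the kernel of p.  The
    squared norms of the peeled vectors sum up to Tr p, by Parseval and Fubini. *)
Lemma density_mixture p : is_density p -> exists v : nat -> H, mixture p v.
Proof.
move=> [p0 pcvg trp].
have bP : is_onb (fun e : @some_onb R H => val e).
  by apply: (@some_onbP p); rewrite trp oner_neq0.
have psum : \esum_(e in [set: @some_onb R H]) (qf p (val e))%:E = 1%:E.
  apply: esum_of_cvg => [e|]; first exact: qf_ge0.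
  have -> : partial_sum (fun e : @some_onb R H => qf p (val e)) =
      fun A => reC (diag_sum p A).
    by apply/funext => A; rewrite /diag_sum !partial_sumE reC_sum.
  have pl : diag_sum p @ totally --> (1 : C) by rewrite -trp.
  exact: cvg_reC pl.
have [enu oP] := summable_enum (fun e => qf_ge0 (val e) p0) psum.
pose e n := if enu n is Some b then val b else 0.
have bE (b : @some_onb R H) : exhausted p e (val b).
  have [qb|qb] := eqVneq (qf p (val b)) 0.
    exists 0%N => n _; apply: qf_eq0; first exact: residue_pos.
    by apply/eqP; rewrite eq_le qf_ge0 ?andbT -?qb ?residue_le //; exact: residue_pos.
  have [m enum_m] := oP _ qb; exists m.+1 => n mn.
  by have := residue_ker e p0 mn; rewrite {2}/e enum_m.
have pE x := peeled_sum p0 x bP bE.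
exists (peeled p e); split=> //.
under eq_esum do rewrite -(parseval bP).
rewrite esum_swap; last by move=> *; rewrite lee_fin cnormsq_ge0.
apply: (@le_lt_trans _ _ 1%:E); last exact: ltry.
rewrite -psum; apply: le_esum => b _; rewrite pE; apply: le_esum => n _.
by rewrite innerC cnormsq_conj.
Qed.

End DensityDecomposition.

(** * Operators on the tensor product *)

Section TensorOperators.
Variables (R : realType) (H K HK : hilbertType R).
Local Notation C := (Cplx R).
Variables (tens : {bilinear H -> K -> HK}) (tensP : is_hilbert_tensor tens).

Lemma tens_inner u v u' v' :
  inner (tens u v) (tens u' v') = inner u u' * inner v v'.
Proof. by case: tensP. Qed.

Lemma tens_linear v : linear (fun u => tens u v).
Proof. by move=> a x y; rewrite linearDl linearZl_LR. Qed.

Lemma sqn_tens u v : sqn (tens u v) = sqn u * sqn v.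
Proof. by apply: toC_inj; rewrite toCM -!sqnE tens_inner. Qed.

Lemma norm_tens u v : `|tens u v| = `|u| * `|v|.
Proof.
apply/eqP; rewrite -(@eqrXn2 _ 2) ?mulr_ge0 //.
by rewrite exprMn !norm_sqn sqn_tens toCM.
Qed.

(** Bounded operators are determined on elementary tensors, whose span is dense. *)
Lemma tens_eq (S T : 'B(HK)) :
  (forall u v, S (tens u v) = T (tens u v)) -> S = T.
Proof.
move=> ST; apply: bop_ext => x; apply/eqP; rewrite -subr_eq0.
have [c c0 Dc] := bop_sqn (S - T).
have sE y : (S - T) y = S y - T y by [].
apply/eqP/sqn_eq0; rewrite -sE; apply/eqP; rewrite eq_le sqn_ge0 andbT.
apply/ler_addgt0Pr => e e0; rewrite add0r.
have d0 : 0 < e / (c + 1) by apply: divr_gt0 => //; lra.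
have xc : closure (lspan [set w | exists u v, w = tens u v]) x.
  by case: tensP => _ ->.
have [y [n [a [u [uP yE]]]] xy] := closure_sqn xc d0.
have Dy : (S - T) y = 0.
  rewrite yE; elim/big_ind: _ => [|x1 x2 h1 h2|i _]; first exact: bop0.
    by rewrite bopD h1 h2 addr0.
  by rewrite bopZ; have [u' [v' ->]] := uP i; rewrite sE ST subrr scaler0.
have -> : (S - T) x = (S - T) (x - y) by rewrite bopB Dy subr0.
apply: le_trans (Dc _) _; move: xy; rewrite ltr_pdivlMr; last lra.
have := sqn_ge0 (x - y); nra.
Qed.

Section Slice.
Variable v : K.

Lemma slice_exists : exists S : HK -> H, [/\ linear S,
  (forall x, `|S x| <= `|v| * `|x|) & forall x h, inner (S x) h = inner x (tens h v)].
Proof.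
apply: adjoint_exists (normr_ge0 v) _; first exact: tens_linear.
by move=> h; rewrite norm_tens mulrC.
Qed.

(** The adjoint of u |-> u (x) v, i.e. the partial inner product with v. *)
Definition slice : HK -> H := projT1 (cid slice_exists).

Lemma slice_inner x h : inner (slice x) h = inner x (tens h v).
Proof. by rewrite /slice; case: cid => S [? ? ?] /=. Qed.

Lemma slice_linear : linear slice.
Proof. by rewrite /slice; case: cid => S [? ? ?] /=. Qed.

Lemma slice_norm x : `|slice x| <= `|v| * `|x|.
Proof. by rewrite /slice; case: cid => S [? h ?] /=. Qed.

Lemma slice_tens u v' : slice (tens u v') = inner v' v *: u.
Proof.
by apply: inner_eql => h; rewrite slice_inner tens_inner innerZl mulrC.
Qed.

End Slice.

(** For a rank-one second factor the tensor product of operators is the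
    composite of slice v', S and u |-> u (x) v, hence exists. *)
Lemma optens_ketbra (S : 'B(H)) v v' x :
  optens tens S (ketbra v v') x = tens (S (slice v' x)) v.
Proof.
have lin : linear (fun x => tens (S (slice v' x)) v).
  by move=> a y z; rewrite (slice_linear v') bop_linear tens_linear.
have bnd : exists2 c : C, 0 <= c & forall x, `|tens (S (slice v' x)) v| <= c * `|x|.
  have [c c0 Sc] := bop_bounded S; exists (c * `|v'| * `|v|).
    by rewrite !mulr_ge0.
  move=> y; rewrite norm_tens mulrAC ler_wpM2r //; apply: le_trans (Sc _) _.
  by rewrite -mulrA ler_wpM2l // slice_norm.
have UP : (fun x => tens (S (slice v' x)) v) \in @bounded_op R HK by apply/asboolP.
have ex : exists U : 'B(HK), forall u w, U (tens u w) = tens (S u) (ketbra v v' w).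
  exists (Bop UP) => u w; rewrite /= slice_tens bopZ.
  by rewrite linearZl_LR linearZr_LR.
have oE : forall u w, optens tens S (ketbra v v') (tens u w) = tens (S u) (ketbra v v' w).
  exact: (xgetPex 0 ex).
have -> : optens tens S (ketbra v v') = Bop UP.
  apply: tens_eq => u w; rewrite oE /= slice_tens bopZ.
  by rewrite linearZl_LR linearZr_LR.
by [].
Qed.

End TensorOperators.

(** * The transition map of the walk *)

Section WalkOperators.
Variables (R : realType) (Lambda : countType) (H K HK : hilbertType R).
Local Notation C := (Cplx R).
Variables (tens : {bilinear H -> K -> HK}) (tensP : is_hilbert_tensor tens).
Variables (ket : Lambda -> K) (ketP : is_onb ket).
Variables (B : Lambda -> Lambda -> 'B(H)) (BP : is_oqrw B).

Let W j h := tens h (ket j).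
Let Wt j := slice tensP (ket j).

Lemma at_siteE S j x : at_site tens ket S j x = W j (S (Wt j x)).
Proof. exact: optens_ketbra. Qed.

Lemma slice_ket i j h : Wt i (W j h) = (j == i)%:R *: h.
Proof. by rewrite /Wt slice_tens (onb_inner ketP). Qed.

Lemma sqn_ket j h : sqn (W j h) = sqn h.
Proof. by rewrite sqn_tens // /sqn (onb_inner ketP) eqxx reC1 mulr1. Qed.

Lemma inner_at_site S j x :
  inner (at_site tens ket S j x) x = inner (S (Wt j x)) (Wt j x).
Proof. by rewrite at_siteE innerC -slice_inner -innerC. Qed.

Lemma qf_at_site S j x : qf (at_site tens ket S j) x = qf S (Wt j x).
Proof. by rewrite {1}/qf inner_at_site. Qed.

Lemma at_site_pos S j : positive_op S -> positive_op (at_site tens ket S j).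
Proof. by move=> S0 x; rewrite inner_at_site. Qed.

Lemma sqn_slice_le j x : sqn (Wt j x) <= sqn x.
Proof.
have := slice_norm tensP (ket j) x; rewrite -/(Wt j).
have -> : `|ket j| = 1.
  apply/eqP; rewrite -(@eqrXn2 _ 2) // expr1n inner_norm (onb_inner ketP).
  by rewrite eqxx.
by rewrite mul1r -ler_sqr ?nnegrE // !norm_sqn toC_le.
Qed.

Lemma mixture_at_site (I : choiceType) p (v : I -> H) j :
  mixture p v -> mixture (at_site tens ket p j) (fun i => W j (v i)).
Proof.
move=> [p0 pv vfin]; split; first exact: at_site_pos.
- by move=> x; rewrite qf_at_site pv; apply: eq_esum => i _; rewrite slice_inner.
- by under eq_esum do rewrite sqn_ket.
Qed.

Lemma oqrw_M_ket i j j' h :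
  oqrw_M B tens ket i j (W j' h) = (j' == j)%:R *: W i (B i j h).
Proof.
rewrite /oqrw_M (optens_ketbra tensP) -/(Wt j) slice_ket bopZ.
by rewrite linearZl_LR.
Qed.

Lemma oqrw_esum j h :
  \esum_(i in [set: Lambda]) (sqn (B i j h))%:E = (sqn h)%:E.
Proof.
apply: esum_of_cvg => [i|]; first exact: sqn_ge0.
have h1 := cvg_reC (cvg_innerl (y := h) (@BP j h)).
have -> : partial_sum (fun i => sqn (B i j h)) =
    fun A => reC (inner (partial_sum (fun i => (adj (B i j) * B i j) h) A) h).
  apply/funext => A; rewrite !partial_sumE inner_suml reC_sum.
  by apply: eq_bigr => i _; rewrite /= adjP.
exact: h1.
Qed.

Section Et.
Variables (M2 : cstarType R) (J2 : bool -> 'B(HK) -> M2).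
Variables (Et : M2 -> 'B(HK)) (p : 'B(H)) (EtP : is_Et B tens ket p J2 Et).
Variables (x y : 'B(HK)) (c : Lambda -> R).
Hypothesis c0 : forall j, 0 <= c j.
Hypothesis cE : forall j, Tr (at_site tens ket p j * x) = toC (c j).
Hypothesis y0 : positive_op y.

Lemma Et_cvg xi : partial_sum (fun ij : Lambda * Lambda =>
    toC (c ij.2 * qf y (oqrw_M B tens ket ij.1 ij.2 xi))) @ totally -->
  inner (Et (tensor2 J2 x y) xi) xi.
Proof.
have h1 := cvg_innerl (y := xi) (@EtP x y xi).
have -> : partial_sum (fun ij => toC (c ij.2 * qf y (oqrw_M B tens ket ij.1 ij.2 xi))) =
    fun A => inner (partial_sum (fun ij : Lambda * Lambda =>
      (Tr (at_site tens ket p ij.2 * x) *: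
       (adj (oqrw_M B tens ket ij.1 ij.2) * y * oqrw_M B tens ket ij.1 ij.2)) xi) A) xi.
  apply/funext => A; rewrite !partial_sumE inner_suml.
  apply: eq_bigr => ij _; rewrite cE innerZl toCM; congr (_ * _).
  by rewrite /= adjP pos_inner.
exact: h1.
Qed.

Lemma Et_qf xi : (qf (Et (tensor2 J2 x y)) xi)%:E =
  \esum_(ij in [set: Lambda * Lambda])
     (c ij.2 * qf y (oqrw_M B tens ket ij.1 ij.2 xi))%:E.
Proof.
apply/esym/esum_of_cvg => [ij|]; first by rewrite mulr_ge0 // qf_ge0.
have h := cvg_reC (Et_cvg (xi := xi)).
have -> : partial_sum (fun ij => c ij.2 * qf y (oqrw_M B tens ket ij.1 ij.2 xi)) =
   fun A => reC (partial_sum (fun ij : Lambda * Lambda =>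
    toC (c ij.2 * qf y (oqrw_M B tens ket ij.1 ij.2 xi))) A).
  by apply/funext => A; rewrite !partial_sumE reC_sum.
exact: h.
Qed.

Lemma Et_pos : positive_op (Et (tensor2 J2 x y)).
Proof.
move=> xi; have h := Et_cvg (xi := xi).
have : partial_sum (fun ij : Lambda * Lambda =>
    toC (c ij.2 * qf y (oqrw_M B tens ket ij.1 ij.2 xi))) @ totally -->
   toC (qf (Et (tensor2 J2 x y)) xi).
  have -> : partial_sum (fun ij : Lambda * Lambda =>
      toC (c ij.2 * qf y (oqrw_M B tens ket ij.1 ij.2 xi))) =
    fun A => toC (reC (partial_sum (fun ij : Lambda * Lambda =>
      toC (c ij.2 * qf y (oqrw_M B tens ket ij.1 ij.2 xi))) A)).
    apply/funext => A; rewrite !partial_sumE reC_sum.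
    exact/esym/(rmorph_sum (@real_complex R)).
  exact: cvg_toC (cvg_reC h).
move=> h2; rewrite (cvgC_unique h h2) toC_ge0 -lee_fin Et_qf.
by apply: esum_ge0 => ij _; rewrite lee_fin mulr_ge0 // qf_ge0.
Qed.

(** The M_ij with a source site other than j vanish on h (x) |j>, so a single
    weight comes out. *)
Lemma Et_ket j h : (qf (Et (tensor2 J2 x y)) (W j h))%:E =
  ((c j)%:E * \esum_(i in [set: Lambda]) (qf y (W i (B i j h)))%:E)%E.
Proof.
rewrite Et_qf esum_pairE => [|ij]; last by rewrite lee_fin mulr_ge0 // qf_ge0.
rewrite (@esum_only _ _ j) /=.
- rewrite -esumZ // => [|i]; last by rewrite lee_fin qf_ge0.
  by apply: eq_esum => i _; rewrite oqrw_M_ket eqxx scale1r EFinM.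
- by apply: esum_ge0 => i _; rewrite lee_fin mulr_ge0 // qf_ge0.
move=> j' j'j; rewrite esum1 // => i _; rewrite oqrw_M_ket.
have /negPf -> : j != j' by apply/eqP => e; apply: j'j.
by rewrite scale0r /qf inner0r mulr0.
Qed.

End Et.
End WalkOperators.

(** * Recurrence as a limit *)

Section RecurrenceCriterion.
Variables (R : realType) (L : hilbertType R) (M2 M : cstarType R).
Local Notation C := (Cplx R).
Variables (J2 : bool -> 'B(L) -> M2) (J : nat -> 'B(L) -> M).
Variables (JP : is_spatial_tensor J) (beta : M -> M) (betaP : is_shift J beta).
Variables (phi0 : 'B(L) -> C) (Et : M2 -> 'B(L)) (phi : M -> C).
Hypothesis phiP : is_qmc J2 J phi0 Et phi.

(** The effect, in the Heisenberg picture, of finding 1 - e at N consecutive times,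
    the present one being the first. *)
Definition survival (e : 'B(L)) N : 'B(L) :=
  iter N (fun y => Et (tensor2 J2 (1 - e) y)) 1.

Let phiB a b : phi (a - b) = phi a - phi b.
Proof.
have [[lin _ _] _] := phiP.
by rewrite addrC -scaleN1r lin mulN1r addrC.
Qed.

Lemma rep_compl i e : J i e = 1 - J i (1 - e).
Proof.
have [/(_ i)[lin J1 _ _] _ _ _] := JP.
have -> : 1 - e = -1 *: e + 1 by rewrite scaleN1r addrC.
by rewrite lin J1 scaleN1r opprD opprK addrCA subrr addr0.
Qed.

Lemma qmc_survival e N : phi (J 0 e * \prod_(i < N) J i.+1 (1 - e)) =
  phi0 (Et (tensor2 J2 e (survival e N))).
Proof.
have [_ /(_ (fun i => if i is _.+1 then 1 - e else e) N)] := phiP.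
rewrite big_ord_recl /= => ->; congr (phi0 (Et (tensor2 J2 e _))).
have mapE (m : nat) : (0 < m)%N ->
    [seq (if i is _.+1 then 1 - e else e) | i <- iota m N] = nseq N (1 - e).
  by elim: N m => //= N IH [//|m] _; rewrite IH.
by rewrite mapE // /survival; elim: N {mapE} => //= n ->.
Qed.

Lemma shifted_tau e n : phi (J 0 e * beta (tau J e n)) =
  phi (J 0 e * \prod_(i < n) J i.+1 (1 - e)) -
  phi (J 0 e * \prod_(i < n.+1) J i.+1 (1 - e)).
Proof.
have [_ b1 bM _ bJ] := betaP.
rewrite -phiB -mulrBr /tau bM (big_morph _ bM b1) bJ.
under eq_bigr do rewrite bJ.
congr (phi (_ * _)); rewrite big_ord_recr /= {1}(rep_compl n.+1 e).
by rewrite [LHS]mulrBr mulr1.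
Qed.

(** The partial sums of the recurrence series telescope to f 0 - f N. *)
Lemma recurrentE e : recurrent J beta phi e <->
  phi0 (Et (tensor2 J2 e 1)) != 0 /\
  phi0 (Et (tensor2 J2 e (survival e N))) @[N --> \oo] --> (0 : C).
Proof.
pose f N : C := phi0 (Et (tensor2 J2 e (survival e N))).
have f0 : phi (J 0 e) = f 0.
  by rewrite /f -qmc_survival big_ord0 mulr1.
have sE N : \sum_(n < N) phi (J 0 e * beta (tau J e n)) = f 0 - f N.
  elim: N => [|N IH]; first by rewrite big_ord0 subrr.
  rewrite big_ord_recr /= IH shifted_tau !qmc_survival -/(f N) -/(f N.+1).
  by rewrite addrA subrK.
have f0' : phi0 (Et (tensor2 J2 e 1)) = f 0 by [].
rewrite /recurrent f0 f0'.
split=> -[fn0 h]; (split; first exact: fn0).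
  have fE N : phi0 (Et (tensor2 J2 e (survival e N))) =
      f 0 + - f 0 * ((f 0)^-1 * \sum_(n < N) phi (J 0 e * beta (tau J e n))).
    by rewrite sE mulNr mulrA mulfV // mul1r subKr.
  have -> := funext fE.
  have hl := @cvgC_affine _ _ _ _ _ (f 0) (- f 0) _ h.
  rewrite mulr1 subrr in hl.
  exact: hl.
have fE N : (f 0)^-1 * \sum_(n < N) phi (J 0 e * beta (tau J e n)) =
    1 + - (f 0)^-1 * f N.
  by rewrite sE mulrBr mulVf // mulNr.
have -> := funext fE.
have hl := @cvgC_affine _ _ _ _ _ 1 (- (f 0)^-1) _ h.
rewrite mulr0 addr0 in hl.
exact: hl.
Qed.

End RecurrenceCriterion.

(** * Avoidance events in path space *)

Section Measure.
Variable R : realType.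

Lemma measure_countable_bigcup d (T : measurableType d) (mu : {measure set T -> \bar R})
    (I : countType) (F : I -> set T) :
  (forall i, measurable (F i)) -> trivIset setT F ->
  mu (\bigcup_i F i) = \esum_(i in [set: I]) mu (F i).
Proof.
move=> mF tF.
pose G n := if @choice.unpickle I n is Some i then F i else set0.
have -> : \bigcup_i F i = \bigcup_(i in range (@choice.pickle I)) G i.
  by rewrite bigcup_image; apply: eq_bigcupr => i _; rewrite /G choice.pickleK.
have mG n : measurable (G n).
  by rewrite /G; case: choice.unpickle.
have tG : trivIset (range (@choice.pickle I)) G.
  move=> _ _ [i _ <-] [j _ <-]; rewrite /G !choice.pickleK => h.
  by congr choice.pickle; exact: tF h.
rewrite measure_bigcup //.
rewrite nneseries_esum ?set_mem_set //.
rewrite esum_image; last by move=> i j _ _; exact: (pcan_inj choice.pickleK).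
by apply: eq_esum => i _; rewrite /G choice.pickleK.
Qed.

Lemma measure_setI_sure d (T : measurableType d) (P : probability T R)
    (A S : set T) : measurable A -> measurable S -> P S = 1%E ->
  P A = P (S `&` A).
Proof.
move=> mA mS PS; rewrite -[A in LHS](setUIDK A S) measureU; last 3 first.
- exact: measurableI.
- exact: measurableD.
- by rewrite setIACA setICr setI0.
rewrite setIC [X in (_ + X)%E](_ : _ = 0%E) ?adde0 //.
apply/eqP; rewrite eq_le measure_ge0 andbT.
have <- : P (~` S) = 0%E by rewrite probability_setC // PS subee.
by apply: le_measure; rewrite ?inE; [exact: measurableD|exact: measurableC|
  move=> x []].
Qed.

End Measure.

Section PathEvents.
Variables (R : realType) (Lambda : countType) (k : Lambda).

Lemma measurable_cylinder s : measurable (cylinder k s : set (path_space k)).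
Proof. by apply: sub_gen_smallest; exists s. Qed.

Lemma measurable_at n i : measurable ([set w | w n = i] : set (path_space k)).
Proof.
have -> : [set w : path_space k | w n = i] =
    \bigcup_(s in [set: seq Lambda]) (if size s == n then cylinder k (rcons s i) else set0).
  apply/seteqP; split=> [w /= wn|w [s _]].
    exists (mkseq w n) => //; rewrite size_mkseq eqxx /cylinder /=.
    by rewrite size_rcons size_mkseq mkseqS wn.
  case: eqP => // sn; rewrite /cylinder /= size_rcons sn => h.
  have := congr1 (nth i ^~ n) h.
  by rewrite nth_mkseq // nth_rcons sn ltnn eqxx.
apply: countable_bigcupT_measurable => [|s]; first exact: countableP.
by case: eqP => // _; exact: measurable_cylinder.
Qed.

Lemma hitting_ltoo (w : path_space k) :
  (hitting_time R k w < +oo)%E <-> exists2 n, (0 < n)%N & w n = k.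
Proof.
split=> [|[n n0 wn]].
  move=> h; apply: contrapT => no; move: h.
  rewrite /hitting_time (_ : [set _ | _ in _] = set0) ?ereal_inf0 //.
  by apply/seteqP; split=> // x [n [n0 wn] _]; apply: no; exists n.
apply: (@le_lt_trans _ _ n%:R%:E); last exact: ltry.
by apply: ereal_inf_lbound; exists n.
Qed.

Definition hits : set (path_space k) := [set w | (hitting_time R k w < +oo)%E].

Lemma hitsE : hits = \bigcup_(n in [set: nat]) [set w | w n.+1 = k].
Proof.
apply/seteqP; split=> [w /hitting_ltoo[[//|n] _ wn]|w [n _ wn]]; first by exists n.
by apply/hitting_ltoo; exists n.+1.
Qed.

Lemma measurable_hits : measurable hits.
Proof. by rewrite hitsE; apply: bigcupT_measurable => n; exact: measurable_at. Qed.

(** The prefix s is there for the induction on N, which splits the event according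
    to the next site and lengthens s. *)
Definition avoiding N s : set (path_space k) :=
  [set w | cylinder k (k :: s) w /\
           forall m, (size s < m <= size s + N)%N -> w m <> k].

Lemma avoiding0 s : avoiding 0 s = cylinder k (k :: s).
Proof.
apply/seteqP; split=> [w []|w kw] //; split=> // m.
by rewrite addn0 => /andP[/leq_trans h /h]; rewrite ltnn.
Qed.

Lemma cylinder_rcons s i (w : path_space k) :
  cylinder k (rcons s i) w <-> cylinder k s w /\ w (size s) = i.
Proof.
rewrite /cylinder /= size_rcons mkseqS; split=> [|[-> ->]//].
by move=> /eqP; rewrite eqseq_rcons => /andP[/eqP -> /eqP].
Qed.

Lemma avoidingS N s : avoiding N.+1 s =
  \bigcup_(i in [set: Lambda]) (if i == k then set0 else avoiding N (rcons s i)).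
Proof.
apply/seteqP; split=> [w [kw aw]|w [i _]].
  exists (w (size s).+1) => //.
  have wk : w (size s).+1 <> k by apply: aw; rewrite ltnSn addnS ltnS leq_addr.
  move/eqP/negPf: (wk) => ->; split.
    by rewrite -rcons_cons cylinder_rcons.
  move=> m; rewrite size_rcons addSnnS => /andP[h1 h2]; apply: aw.
  by rewrite h2 (ltn_trans (ltnSn _) h1).
case: eqP => // ik [] ; rewrite -rcons_cons cylinder_rcons => -[kw wi] aw.
split=> // m /andP[]; rewrite leq_eqVlt => /predU1P[<- _|h1 h2].
  by rewrite wi.
by apply: aw; rewrite size_rcons h1 addSnnS.
Qed.

Lemma measurable_avoiding N s : measurable (avoiding N s).
Proof.
elim: N s => [|N IH] s; first by rewrite avoiding0; exact: measurable_cylinder.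
rewrite avoidingS; apply: countable_bigcupT_measurable => [|i]; first exact: countableP.
by case: eqP.
Qed.

Lemma trivIset_avoiding N s : trivIset setT
  (fun i => if i == k then set0 else avoiding N (rcons s i)).
Proof.
move=> i j _ _ [w []]; case: eqP => // _; case: eqP => // _.
by move=> [+ _] [+ _]; rewrite -!rcons_cons !cylinder_rcons => -[_ <-] [_ <-].
Qed.

Variable P : probability (path_space k) R.
Hypothesis P0 : P [set w | w 0 = k] = 1%E.

Lemma bigcap_avoiding : \bigcap_N avoiding N [::] = [set w | w 0 = k] `\` hits.
Proof.
apply/seteqP; split=> [w aw|w [w0 hw] N _].
  split; first by have [] := aw 0 I; rewrite /cylinder /= => -[].
  move=> /hitting_ltoo[n n0 wn]; have [_] := aw n I.
  by move=> /(_ n) /=; rewrite add0n leqnn n0 => /(_ isT).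
split; first by rewrite /cylinder /mkseq /= w0.
move=> m /andP[m0 _] wm; apply: hw; apply/hitting_ltoo; by exists m.
Qed.

Lemma cvg_avoiding : fine (P (avoiding N [::])) @[N --> \oo] --> fine (P (~` hits)).
Proof.
have mh := measurable_hits.
have m0 := measurable_at 0 k.
have -> : P (~` hits) = P (\bigcap_N avoiding N [::]).
  rewrite bigcap_avoiding setDE [LHS](measure_setI_sure _ m0 P0) //; exact: measurableC.
apply: fine_cvg; rewrite fineK ?fin_num_measure //; last first.
  by apply: bigcap_measurable => // N _; exact: measurable_avoiding.
apply: nonincreasing_cvg_mu.
- by rewrite ltey_eq fin_num_measure //; exact: measurable_avoiding.
- by move=> N; exact: measurable_avoiding.
- by apply: bigcap_measurable => // N _; exact: measurable_avoiding.
move=> m n mn; apply/subsetPset => w [kw aw]; split=> // i /andP[i1 i2].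
by apply: aw; rewrite i1 (leq_trans i2) // leq_add2l.
Qed.

Lemma hits_sure : P hits = 1%E <-> fine (P (~` hits)) = 0.
Proof.
have mh := measurable_hits.
rewrite probability_setC // -(fineK (fin_num_measure P _ mh)) -EFinB /=.
by split=> [[->]|/subr0_eq <-]; rewrite ?subrr.
Qed.

End PathEvents.
Arguments avoiding {Lambda} k N s.
Arguments hits R {Lambda} k.

(** * The law of the walk through vector states *)

Section VectorWalk.
Variables (R : realType) (Lambda : countType) (H : hilbertType R).
Local Notation C := (Cplx R).
Variables (B : Lambda -> Lambda -> 'B(H)) (k : Lambda).

(** Unnormalised probability that the walk started at site j in the pure state h
    avoids k during its first N steps. *)
Fixpoint avoid_mass N (j : Lambda) (h : H) : \bar R :=
  if N is N'.+1 then
    \esum_(i in [set: Lambda]) (if i == k then 0%E else avoid_mass N' i (B i j h))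
  else (sqn h)%:E.

Lemma avoid_mass_ge0 N j h : (0 <= avoid_mass N j h)%E.
Proof.
elim: N j h => [|N IH] j h /=; first by rewrite lee_fin sqn_ge0.
by apply: esum_ge0 => i _; case: eqP.
Qed.

Lemma path_op_rcons j s i : path_op B j (rcons s i) = B i (last j s) * path_op B j s.
Proof.
elim: s j => [|a s IH] j /=; first by rewrite mul1r mulr1.
by rewrite IH mulrA.
Qed.

Lemma positive1 : positive_op (1 : 'B(H)).
Proof. by move=> x; exact: inner_self_ge0. Qed.

Lemma mixture_conj (I : choiceType) p (v : I -> H) (S : 'B(H)) : mixture p v ->
  mixture (S * p * adj S) (fun i => S (v i)).
Proof.
move=> [p0 pv vfin].
have qfE x : inner ((S * p * adj S) x) x = inner (p (adj S x)) (adj S x).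
  by rewrite /= innerC -adjP -innerC.
split.
- by move=> x; rewrite qfE.
- by move=> x; rewrite /qf qfE -/(qf p _) pv; apply: eq_esum => i _; rewrite adjP.
have [c c0 Sc] := bop_sqn S.
apply: (@le_lt_trans _ _ (c%:E * \esum_(i in [set: I]) (sqn (v i))%:E)%E).
  rewrite -esumZ // => [|i]; last by rewrite lee_fin sqn_ge0.
  by apply: le_esum => i _; rewrite -EFinM lee_fin.
by apply: lte_mul_pinfty => //; rewrite lee_fin.
Qed.

Variables (p : 'B(H)) (v : nat -> H) (pv : mixture p v).
Hypothesis onbH : is_onb (fun e : @some_onb R H => val e).
Variables (P : probability (path_space k) R) (PP : is_oqrw_law B p P).

Lemma law_cylinder s :
  P (cylinder k (k :: s)) = \esum_(n in [set: nat]) (sqn (path_op B k s (v n)))%:E.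
Proof.
have [_ /(_ s)] := PP.
have mS := mixture_conj (path_op B k s) pv.
have := trace_formula onbH mS positive1; rewrite mulr1 => -> /complexI.
have Pfin : P (cylinder k (k :: s)) \is a fin_num.
  by apply: fin_num_measure; exact: measurable_cylinder.
move=> h; rewrite -(fineK Pfin) h -fin_of_lt //.
  exact/mix_mean_ge0/positive1.
by apply: mix_mean_fin; case: mS.
Qed.

(** Both sides split over the next site; at N = 0 this is the trace formula for
    the operator path_op s * p * adj (path_op s), the mixture of the vectors
    path_op s (v n). *)
Lemma law_avoiding N s :
  P (avoiding k N s) =
  \esum_(n in [set: nat]) avoid_mass N (last k s) (path_op B k s (v n)).
Proof.
elim: N s => [|N IH] s; first by rewrite avoiding0 law_cylinder.
rewrite avoidingS measure_countable_bigcup; last 2 first.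
- by move=> i; case: eqP => // _; exact: measurable_avoiding.
- exact: trivIset_avoiding.
rewrite [RHS]esum_swap => [|n i]; last by case: eqP => // _; exact: avoid_mass_ge0.
apply: eq_esum => i _; case: eqP => ik.
  by rewrite measure0 esum1.
apply: (etrans (IH (rcons s i))); rewrite last_rcons.
by apply: eq_esum => n _; rewrite path_op_rcons.
Qed.

End VectorWalk.

(** * Survival operators of the walk *)

Section Survival.
Variables (R : realType) (Lambda : countType) (H K HK : hilbertType R).
Local Notation C := (Cplx R).
Variables (tens : {bilinear H -> K -> HK}) (tensP : is_hilbert_tensor tens).
Variables (ket : Lambda -> K) (ketP : is_onb ket).
Variables (B : Lambda -> Lambda -> 'B(H)) (BP : is_oqrw B).
Variables (p : 'B(H)) (v : nat -> H) (pv : mixture p v).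
Variables (M2 : cstarType R) (J2 : bool -> 'B(HK) -> M2).
Variables (Et : M2 -> 'B(HK)) (EtP : is_Et B tens ket p J2 Et).
Hypothesis onbK : is_onb (fun e : @some_onb R HK => val e).

Lemma site_trace j X : positive_op X ->
  Tr (at_site tens ket p j * X) =
  toC (fine (mix_mean (fun n => tens (v n) (ket j)) X)).
Proof.
by move=> X0; apply: trace_formula => //; exact: (mixture_at_site tensP ketP).
Qed.

Section Weights.
Variables (e : 'B(HK)) (w w' : Lambda -> R).
Hypotheses (w0 : forall j, 0 <= w j) (w'0 : forall j, 0 <= w' j).
Hypothesis wE : forall j, Tr (at_site tens ket p j * e) = toC (w j).
Hypothesis w'E : forall j, Tr (at_site tens ket p j * (1 - e)) = toC (w' j).

Lemma survival_pos N : positive_op (survival J2 Et e N).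
Proof.
elim: N => [|N IH]; first exact: positive1.
exact: (Et_pos EtP w'0 w'E IH).
Qed.

Lemma survival_ket N j h : (qf (survival J2 Et e N.+1) (tens h (ket j)))%:E =
  ((w' j)%:E * \esum_(i in [set: Lambda])
                 (qf (survival J2 Et e N) (tens (B i j h) (ket i)))%:E)%E.
Proof. exact: (Et_ket tensP ketP EtP w'0 w'E (survival_pos N)). Qed.

Lemma survival_trace k N :
  Tr (at_site tens ket p k * Et (tensor2 J2 e (survival J2 Et e N))) =
  toC (fine (\esum_(n in [set: nat]) ((w k)%:E * \esum_(i in [set: Lambda])
     (qf (survival J2 Et e N) (tens (B i k (v n)) (ket i)))%:E))%E).
Proof.
rewrite site_trace; last exact: (Et_pos EtP w0 wE (survival_pos N)).
congr (toC (fine _)); apply: eq_esum => n _.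
exact: (Et_ket tensP ketP EtP w0 wE (survival_pos N)).
Qed.

(** The weight of the complement of e at a site is the indicator that the walk is
    not at k.  The survival operator constrains the present site as well, while
    avoid_mass constrains only the later ones: hence the sum over one more step
    on the left. *)
Lemma survival_avoid k N j h : (forall i, w' i = (i != k)%:R) ->
  (\esum_(i in [set: Lambda]) (qf (survival J2 Et e N) (tens (B i j h) (ket i)))%:E) =
  avoid_mass B k N j h.
Proof.
move=> w'k; elim: N j h => [|N IH] j h.
  rewrite /= -(oqrw_esum BP j); apply: eq_esum => i _.
  by rewrite -(sqn_ket tensP ketP i).
apply: eq_esum => i _; rewrite survival_ket IH w'k.
by case: eqP => _; rewrite ?mul0e ?mul1e.
Qed.

Lemma survival_le q N j h : 0 <= q -> (forall i, w' i <= q) ->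
  (\esum_(i in [set: Lambda])
     (qf (survival J2 Et e N) (tens (B i j h) (ket i)))%:E <=
   (q ^+ N * sqn h)%:E)%E.
Proof.
move=> q0 w'q; elim: N j h => [|N IH] j h.
  rewrite expr0 mul1r -(oqrw_esum BP j); apply: le_esum => i _.
  by rewrite -(sqn_ket tensP ketP i).
rewrite EFinM -(oqrw_esum BP j) -esumZ ?exprn_ge0 // => [|i]; last first.
  by rewrite lee_fin sqn_ge0.
apply: le_esum => i _; rewrite survival_ket exprS EFinM -muleA.
rewrite -[((q ^+ N)%:E * _)%E]EFinM.
apply: lee_pmul; rewrite ?lee_fin //.
by apply: esum_ge0 => i' _; rewrite lee_fin qf_ge0 //; exact: survival_pos.
Qed.

End Weights.
End Survival.

(** * The recurrence theorem *)

Section Projections.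
Variables (R : realType) (H : hilbertType R).

Lemma projection_inner (Q : 'B(H)) x : is_projection Q ->
  inner (Q x) x = toC (sqn (Q x)).
Proof.
move=> [QQ Qs]; rewrite -sqnE -adjP Qs.
by rewrite -{1}QQ.
Qed.

Lemma projection_pos (Q : 'B(H)) : is_projection Q -> positive_op Q.
Proof. by move=> QP x; rewrite projection_inner // toC_ge0 sqn_ge0. Qed.

Lemma projection_le (Q : 'B(H)) x : is_projection Q -> qf Q x <= sqn x.
Proof.
move=> QP; have qE : qf Q x = sqn (Q x) by rewrite /qf projection_inner.
have := sqn_ge0 (Q x - x); rewrite sqnB -/(qf Q x) -qE; lra.
Qed.

Lemma compl_pos (T : 'B(H)) : positive_op T -> (forall x, qf T x <= sqn x) ->
  positive_op (1 - T).
Proof.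
move=> T0 T1 x.
have -> : (1 - T) x = x - T x by [].
by rewrite innerBl sqnE pos_inner // -toCB toC_ge0 subr_ge0.
Qed.

Lemma mix_mean_compl (I : choiceType) (v : I -> H) T : positive_op T ->
  (forall x, qf T x <= sqn x) ->
  (mix_mean v T + mix_mean v (1 - T)%R)%E = mix_mean v 1.
Proof.
move=> T0 T1; have C0 := compl_pos T0 T1.
rewrite /mix_mean -esumD => [|i _|i _]; try by rewrite lee_fin qf_ge0.
apply: eq_esum => i _; rewrite -EFinD; congr (_%:E).
have -> : qf (1 - T) (v i) = sqn (v i) - qf T (v i) by rewrite /qf innerBl reCB.
by rewrite addrC subrK.
Qed.

End Projections.

Theorem theorem5p6 (R : realType) (Lambda : countType)
    (H K HK : hilbertType R)
    (tens : {bilinear H -> K -> HK}) (tensP : is_hilbert_tensor tens)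
    (ket : Lambda -> K) (ketP : is_onb ket)
    (B : Lambda -> Lambda -> 'B(H)) (BP : is_oqrw B)
    (k : Lambda) (p : 'B(H)) (pP : is_density p)
    (Q : 'B(H)) (QP : is_projection Q)
    (P : probability (path_space k) R) (PP : is_oqrw_law B p P)
    (M2 : cstarType R) (J2 : bool -> 'B(HK) -> M2) (J2P : is_spatial_tensor J2)
    (M : cstarType R) (J : nat -> 'B(HK) -> M) (JP : is_spatial_tensor J)
    (beta : M -> M) (betaP : is_shift J beta)
    (Et : M2 -> 'B(HK)) (Et_cp : is_cp_unital Et)
    (EtP : is_Et B tens ket p J2 Et)
    (phi : M -> Cplx R)
    (phiP : is_qmc J2 J (fun x => Tr (at_site tens ket p k * x)) Et phi) :
  (Tr (p * Q) = 1 ->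
     (recurrent J beta phi (at_site tens ket Q k) <->
      P [set w | (hitting_time R k w < +oo)%E] = 1%E)) /\
  (Tr (p * Q) < 1 ->
     recurrent J beta phi (1 - at_site tens ket Q k)).
Proof.
(* The bases used by the traces exist because Tr p = 1 and phi 1 = 1. *)
have onbH : is_onb (fun e : @some_onb R H => val e).
  by apply: (@some_onbP _ _ p); case: pP => _ _ ->; exact: oner_neq0.
have E1 : Et (tensor2 J2 1 1) = 1.
  have [_ Et1 _] := Et_cp; have [J2s _ _ _] := J2P.
  by rewrite /tensor2; have [_ -> _ _] := J2s false; have [_ -> _ _] := J2s true;
     rewrite mulr1.
have onbK : is_onb (fun e : @some_onb R HK => val e).
  apply: (@some_onbP _ _ (at_site tens ket p k * 1)).
  have [[_ _ phi1] phiE] := phiP.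
  have := phiE (fun=> 1) 0%N; rewrite big_ord1 /= E1 => <-.
  have [/(_ 0%N)[_ -> _ _] _ _ _] := JP; rewrite phi1; exact: oner_neq0.
have [v pv] := density_mixture pP.
have vfin : (\esum_(n in [set: nat]) (sqn (v n))%:E < +oo)%E by case: pv.
have v1 : mix_mean v 1 = 1%E.
  have := trace_formula onbH pv (@positive1 R H); rewrite mulr1.
  have [_ _ ->] := pP; rewrite -toC1 => /toC_inj m1.
  rewrite (fin_of_lt (mix_mean_ge0 v (@positive1 R H)) (mix_mean_fin 1 vfin)).
  by rewrite -m1.
have Q0 := projection_pos QP.
pose q := fine (mix_mean v Q).
have trQ : Tr (p * Q) = toC q by exact: trace_formula.
have qE : mix_mean v Q = q%:E.
  exact: fin_of_lt (mix_mean_ge0 v Q0) (mix_mean_fin Q vfin).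
have q0 : 0 <= q by rewrite -lee_fin -qE; exact: mix_mean_ge0.
have q1 : q <= 1.
  rewrite -lee_fin -qE -v1; apply: le_esum => n _; rewrite lee_fin.
  exact: projection_le.
set e := at_site tens ket Q k.
have e0 : positive_op e by exact: at_site_pos.
have e1 x : qf e x <= sqn x.
  rewrite /e (qf_at_site tensP); apply: le_trans (projection_le _ QP) _.
  exact: sqn_slice_le.
have meanE j : mix_mean (fun n => tens (v n) (ket j)) e = (q * (j == k)%:R)%:E.
  rewrite EFinM -qE muleC /mix_mean -esumZ // => [|n]; last by rewrite lee_fin qf_ge0.
  apply: eq_esum => n _; rewrite -EFinM /e (qf_at_site tensP) slice_ket //.
  by case: eqP => _; rewrite ?scale1r ?mul1r // scale0r mul0r qf0.
have mean1 j : mix_mean (fun n => tens (v n) (ket j)) 1 = 1%E.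
  by rewrite -v1; apply: eq_esum => n _; rewrite [qf _ _](sqn_ket tensP ketP).
(* w0, wE: weights of e; w'0, w'E: weights of its complement. *)
have w0 j : 0 <= q * (j == k)%:R by rewrite mulr_ge0.
have w'0 j : 0 <= 1 - q * (j == k)%:R.
  by case: eqP => _; rewrite ?mulr1 ?mulr0 ?subr0 // subr_ge0.
have wE j : Tr (at_site tens ket p j * e) = toC (q * (j == k)%:R).
  by rewrite (site_trace tensP ketP pv onbK) // meanE.
have w'E j : Tr (at_site tens ket p j * (1 - e)) = toC (1 - q * (j == k)%:R).
  rewrite (site_trace tensP ketP pv onbK); last exact: compl_pos.
  have := mix_mean_compl (fun n => tens (v n) (ket j)) e0 e1; rewrite meanE mean1.
  have c0 := mix_mean_ge0 (fun n => tens (v n) (ket j)) (compl_pos e0 e1).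
  case: (mix_mean _ _) c0 => //= r _ re; congr (toC _).
  have r1 : q * (j == k)%:R + r = 1 := EFin_inj re.
  by apply: (addrI (q * (j == k)%:R)); rewrite r1 [RHS]addrC subrK.
split.
  rewrite trQ -toC1 => /toC_inj qq.
  rewrite (recurrentE JP betaP phiP).
  have fE N : Tr (at_site tens ket p k * Et (tensor2 J2 e (survival J2 Et e N))) =
      toC (fine (P (avoiding k N [::]))).
    rewrite (survival_trace tensP ketP pv EtP onbK w0 w'0 wE w'E).
    rewrite (law_avoiding pv onbH PP); congr (toC (fine _)); apply: eq_esum => n _.
    rewrite qq eqxx mulr1 mul1e.
    apply: (survival_avoid tensP ketP BP EtP w'0 w'E) => i.
    by rewrite qq mul1r; case: eqP; rewrite /= ?subrr ?subr0.
  have [P0 _] := PP.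
  have fcvg : toC (fine (P (avoiding k N [::]))) @[N --> \oo] -->
      toC (fine (P (~` hits R k))) by exact: cvg_toC (cvg_avoiding P0).
  have f0 : Tr (at_site tens ket p k * Et (tensor2 J2 e 1)) != 0.
    have := fE 0; rewrite /survival /= => ->.
    rewrite (law_avoiding pv onbH PP).
    by rewrite -[X in fine X]/(mix_mean v 1) v1 /= oner_neq0.
  rewrite -[P _]/(P (hits R k)) hits_sure.
  have cE : (fun N => Tr (at_site tens ket p k *
      Et (tensor2 J2 e (survival J2 Et e N)))) =
      fun N => toC (fine (P (avoiding k N [::]))) by apply/funext.
  split=> [[_]|hit0].
    rewrite cE => h; apply: toC_inj; rewrite toC0.
    have u := cvgC_unique fcvg h.
    exact: u.
  split; first exact: f0.
  rewrite cE; rewrite hit0 toC0 in fcvg; exact: fcvg.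
rewrite trQ -toC1 toC_lt => qq.
rewrite (recurrentE JP betaP phiP).
have ce : 1 - (1 - e) = e by rewrite opprB addrC subrK.
have wcE j : Tr (at_site tens ket p j * (1 - (1 - e))) = toC (q * (j == k)%:R).
  by rewrite ce.
have fE := survival_trace tensP ketP pv EtP onbK w'0 w0 w'E wcE k.
(* Now the projection is 1 - e, so the two families of weights trade places. *)
have spos N : positive_op (survival J2 Et (1 - e) N).
  exact: (survival_pos EtP w0 wcE).
pose m N := (\esum_(n in [set: nat]) ((1 - q * (k == k)%:R)%:E *
  \esum_(i in [set: Lambda])
    (qf (survival J2 Et (1 - e) N) (tens (B i k (v n)) (ket i)))%:E))%E.
have m_ge0 N : (0 <= m N)%E.
  apply: esum_ge0 => n _; rewrite mule_ge0 ?lee_fin // esum_ge0 // => i _.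
  by rewrite lee_fin qf_ge0.
have m_le N : (m N <= (q ^+ N)%:E)%E.
  rewrite -[(q ^+ N)%:E]mule1 -v1 -esumZ ?exprn_ge0 // => [|n]; last first.
    by rewrite lee_fin sqn_ge0.
  apply: le_esum => n _; rewrite -EFinM.
  have wq i : q * (i == k)%:R <= q by case: eqP => _; rewrite ?mulr1 ?mulr0.
  apply: le_trans (survival_le tensP ketP BP EtP w0 wcE N k (v n) q0 wq).
  apply: gee_pMl; rewrite ?lee_fin ?gerBl ?w0 //.
  by apply: esum_ge0 => i _; rewrite lee_fin qf_ge0.
have m_cvg : fine (m N) @[N --> \oo] --> (0 : R).
  have qN : q ^+ N @[N --> \oo] --> (0 : R) by apply: cvg_expr; rewrite ger0_norm.
  apply: (squeeze_cvgr _ (cvg_cst 0) qN); apply: nearW => N.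
  rewrite fine_ge0 //= -lee_fin fineK //.
  by rewrite ge0_fin_numE //; apply: le_lt_trans (m_le N) (ltry _).
split.
  have := fE 0%N; rewrite /survival /= => ->.
  have -> : (\esum_(n in [set: nat]) ((1 - q * (k == k)%:R)%:E *
      \esum_(i in [set: Lambda]) (qf 1 (tens (B i k (v n)) (ket i)))%:E))%E =
      (1 - q)%:E.
    rewrite -[RHS]mule1 -v1 -esumZ ?subr_ge0 // => [|n]; last first.
      by rewrite lee_fin sqn_ge0.
    apply: eq_esum => n _; rewrite eqxx mulr1; congr (_ * _)%E.
    rewrite [RHS](esym (oqrw_esum BP k (v n))); apply: eq_esum => i _.
    by rewrite [qf _ _](sqn_ket tensP ketP).
  by rewrite -toC0 (inj_eq (@toC_inj R)) /= subr_eq0 eq_sym lt_eqF.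
have -> : (fun N => Tr (at_site tens ket p k *
    Et (tensor2 J2 (1 - e) (survival J2 Et (1 - e) N)))) =
    fun N => toC (fine (m N)) by apply/funext.
exact: (cvg_toC m_cvg).
Qed.
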